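(* Let $(P,\mathcal F^+,\mathcal F^-)$ be a bifoliated plane equipped with an Anosov-like action by a group $G$. Then $G$ can be realized as a subgroup of $\mathrm{Homeo}^+(\mathbb R)$, the group of orientation-preserving homeomorphisms of $\mathbb R$.
   Context: A bifoliated plane $(P,\mathcal F^+,\mathcal F^-)$ consists of a topological plane $P$ with two $C^0$ foliations by lines such that each leaf is properly embedded in $P$ and the foliations are topologically transverse (around each point there is a chart mapping leaves of the two foliations to horizontal and vertical straight lines of $\mathbb R^2$, respectively). The foliations are assumed to be non-singular and oriented. The leaf space of a foliation is the quotient of $P$ obtained by identifying each leaf to a point, with the quotient topology. Two leaves of a foliation are non-separated if they do not admit disjoint neighborhoods saturated by leaves of that foliation. Perfect fits: let $l^+$ and $l^-$ be non-intersecting half-leaves of $\mathcal F^+$ and $\mathcal F^-$ respectively. They make a perfect fit if there is an arc $\tau^+$ with an endpoint on $l^+$ and contained in a leaf of $\mathcal F^-$, and an arc $\tau^-$ with an endpoint on $l^-$ and contained in a leaf of $\mathcal F^+$, such that every leaf of $\mathcal F^+$ that intersects the interior of $\tau^+$ intersects $l^-$, and every leaf of $\mathcal F^-$ that intersects the interior of $\tau^-$ intersects $l^+$. Two leaves make a perfect fit if they contain half-leaves making a perfect fit. An action of a group $G$ on $(P,\mathcal F^+,\mathcal F^-)$ which preserves both foliations is called Anosov-like if it satisfies the following: (A1) if a nontrivial element of $G$ fixes a leaf $l$ of $\mathcal F^+$ or $\mathcal F^-$, then it has a fixed point $x\in l$ and is topologically expanding on one leaf through $x$ and topologically contracting on the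 other; (A2) the union of leaves of $\mathcal F^+$ that are fixed by some nontrivial element of $G$ is dense in $P$, as is the union of leaves of $\mathcal F^-$ that are fixed by some nontrivial element of $G$; (A3) each singular point is fixed by some nontrivial element of $G$ (vacuous here, since the foliations are non-singular); (A4) if $l$ is a leaf of $\mathcal F^+$ or $\mathcal F^-$ that is non-separated from some other leaf $l'$ in the corresponding leaf space, then some nontrivial element $g\in G$ fixes $l$; (A5) there are no totally ideal quadrilaterals in $P$, where a totally ideal quadrilateral is a trivially foliated region bounded by four leaves $l_1,l_2\in\mathcal F^+$, $f_3,f_4\in\mathcal F^-$ such that each $l_i$ makes a perfect fit with each $f_j$. *)

(* Defs.v *)
From mathcomp Require Import all_boot all_order all_algebra.
From mathcomp Require Import all_classical all_reals all_analysis.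
Import numFieldNormedType.Exports.

Set Implicit Arguments.
Unset Strict Implicit.
Unset Printing Implicit Defensive.

Local Open Scope classical_set_scope.
Local Open Scope ring_scope.

Definition homeo_on (X Y : topologicalType) (A : set X) (B : set Y)
    (f : X -> Y) : Prop :=
  [/\ set_bij A B f,
      {within A, continuous f}
    & exists2 g : Y -> X, {in A, cancel f g} & {within B, continuous g}].

(* The elements of Homeo^+(R). *)
Definition homeo_plus (R : realType) (f : R -> R) : Prop :=
  homeo_on setT setT f /\ {homo f : x y / x < y}.

Section Foliations.
Variables (R : realType) (P : topologicalType).
Implicit Types (F Fp Fm : set (set P)) (l m h U V Q : set P).

Definition meets (A B : set P) : Prop := A `&` B !=set0.

(* c is a parametrization of l as a properly embedded line.  A line has many
   of them (including, for each one, the reversed one). *)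
Definition proper_line (c : R -> P) l : Prop :=
  [/\ continuous c, injective c,
      (forall K : set P, compact K -> compact (c @^-1` K))
    & range c = l].

(* A foliation is given by its set of leaves F, its orientation by the
   relation "x strictly precedes y on a common leaf". *)
Record foliation_by_oriented_lines F (prec : P -> P -> Prop) : Prop := {
  leaves_partition : partition F id setT;
  prec_same_leaf : forall x y, prec x y -> exists2 l, F l & l x /\ l y;
  leaves_proper_lines : forall l, F l -> exists2 c : R -> P,
    proper_line c l & forall s t, prec (c s) (c t) <-> s < t }.

(* phi maps the plaques in U (the connected components of the traces on U of
   the leaves of F) to the level lines of k. *)
Definition straightens U (phi : P -> R * R) F (k : R * R -> R) : Prop :=
  forall l x, F l -> l x -> U x ->
    connected_component (U `&` l) x = [set y | U y /\ k (phi y) = k (phi x)].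

(* Leaves of Fp become horizontal lines, leaves of Fm vertical ones. *)
Definition bifoliated_chart Fp Fm U (phi : P -> R * R) : Prop :=
  [/\ open U, homeo_on U setT phi,
      straightens U phi Fp snd & straightens U phi Fm fst].

(* The charts are required to carry the orientations to the increasing ones.
   This only says that the orientations of nearby leaves agree: a bifoliated
   chart may always be composed with the two axial symmetries of the plane. *)
Record bifoliated_plane Fp Fm (precp precm : P -> P -> Prop) : Prop := {
  topological_plane :
    exists phi : P -> R * R, homeo_on setT setT phi;
  foliation_p : foliation_by_oriented_lines Fp precp;
  foliation_m : foliation_by_oriented_lines Fm precm;
  bifoliated_charts : forall x, exists U (phi : P -> R * R),
    [/\ U x, bifoliated_chart Fp Fm U phi,
        (forall y z, U y -> U z -> (phi y).2 = (phi z).2 ->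
           (precp y z <-> (phi y).1 < (phi z).1))
      & (forall y z, U y -> U z -> (phi y).1 = (phi z).1 ->
           (precm y z <-> (phi y).2 < (phi z).2))] }.

Definition saturated F U : Prop := forall l, F l -> meets l U -> l `<=` U.

Definition nonseparated F l m : Prop :=
  ~ exists U V, [/\ set_nbhs l U, set_nbhs m V, saturated F U, saturated F V
                  & U `&` V = set0].

(* Half-leaves contain their endpoint: otherwise, two half-leaves issued from
   a common point would be disjoint, and would make a perfect fit. *)
Definition half_leaf l h : Prop :=
  exists (c : R -> P) (a : R), proper_line c l /\ h = c @` `[a, +oo[.

(* One half of the perfect fit condition on half-leaves h of F1 and h' of F2.
   The arc is c @` `[a, b]; the choice of its endpoint c a is no restriction,
   since c can be reversed. *)
Definition perfect_fit_arc F1 F2 h h' : Prop :=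
  exists (l : set P) (c : R -> P) (a b : R),
    [/\ F2 l, proper_line c l, a < b, h (c a)
      & forall m, F1 m -> meets m (c @` `]a, b[) -> meets m h'].

Definition perfect_fit Fp Fm l m : Prop :=
  exists h h', [/\ half_leaf l h, half_leaf m h', h `&` h' = set0,
    perfect_fit_arc Fp Fm h h' & perfect_fit_arc Fm Fp h' h].

Definition totally_ideal_quadrilateral Fp Fm Q (l1 l2 f3 f4 : set P) : Prop :=
  [/\ [/\ Fp l1, Fp l2 & l1 <> l2],
      [/\ Fm f3, Fm f4 & f3 <> f4],
      (exists phi, bifoliated_chart Fp Fm Q phi),
      closure Q `\` Q = l1 `|` l2 `|` f3 `|` f4
    & [/\ perfect_fit Fp Fm l1 f3, perfect_fit Fp Fm l1 f4,
          perfect_fit Fp Fm l2 f3 & perfect_fit Fp Fm l2 f4]].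

Section Actions.
Variables (G : groupType) (act : G -> P -> P).

(* The orientations are part of the foliations that the action preserves. *)
Record bifoliated_action Fp Fm (precp precm : P -> P -> Prop) : Prop := {
  act_one : forall x, act 1%g x = x;
  act_mul : forall (g h : G) x, act (g * h)%g x = act g (act h x);
  act_continuous : forall g, continuous (act g);
  act_Fp : forall g l, Fp l -> Fp (act g @` l);
  act_Fm : forall g l, Fm l -> Fm (act g @` l);
  act_precp : forall g x y, precp x y -> precp (act g x) (act g y);
  act_precm : forall g x y, precm x y -> precm (act g x) (act g y) }.

Definition fixes_leaf (g : G) l : Prop := act g @` l = l.

Definition fixed_by_nontrivial l : Prop :=
  exists2 g : G, g <> 1%g & fixes_leaf g l.

(* For a leaf l fixed by g and a point x of l fixed by g. *)
Definition contracting_on (g : G) l (x : P) : Prop :=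
  forall y, l y -> (fun n : nat => act (g ^+ n)%g y) @ \oo --> x.

Definition expanding_on (g : G) l (x : P) : Prop :=
  contracting_on (g^-1)%g l x.

(* The usual axiom on singular points is vacuous: the foliations have none. *)
Record Anosov_like Fp Fm (precp precm : P -> P -> Prop) : Prop := {
  Anosov_action : bifoliated_action Fp Fm precp precm;
  Anosov_A1 : forall (g : G) l, g <> 1%g -> Fp l \/ Fm l -> fixes_leaf g l ->
    exists x lp lm, [/\ l x, act g x = x, Fp lp /\ lp x, Fm lm /\ lm x
      & (expanding_on g lp x /\ contracting_on g lm x) \/
        (contracting_on g lp x /\ expanding_on g lm x)];
  Anosov_A2p : dense (\bigcup_(l in [set l | Fp l /\ fixed_by_nontrivial l]) l);
  Anosov_A2m : dense (\bigcup_(l in [set l | Fm l /\ fixed_by_nontrivial l]) l);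
  Anosov_A4p : forall l m, Fp l -> Fp m -> l <> m -> nonseparated Fp l m ->
    fixed_by_nontrivial l;
  Anosov_A4m : forall l m, Fm l -> Fm m -> l <> m -> nonseparated Fm l m ->
    fixed_by_nontrivial l;
  Anosov_A5 : ~ exists Q l1 l2 f3 f4,
    totally_ideal_quadrilateral Fp Fm Q l1 l2 f3 f4 }.

End Actions.
End Foliations.

(* Main.v *)
Require Import Defs.
From mathcomp Require Import all_boot all_order all_algebra.
From mathcomp Require Import all_classical all_reals all_analysis.
From mathcomp Require Import ring lra zify.
Import numFieldNormedType.Exports.
Import Order.TTheory GRing.Theory Num.Theory.

(* Think of the positive ends of the leaves of F+ as points of the circle at
   infinity of the plane.  Since the plane is simply connected and G preserves
   the orientations, these ends lift to the universal cover of that circle in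
   a G-equivariant way, and the order of the line pulls back to a G-invariant
   linear order on the leaves of F+.

   The circle is never built.  The lift is encoded by the integers H a x (the
   integral part of the difference of the lifts of the ends of the leaves of x
   and of a): H a is constant on the leaves of F+, and along a leaf of F- it
   jumps when a enters or leaves the quadrant to the right of and above x.
   These jumps are locally consistent, hence consistent by monodromy.  The
   order is [0 <= H a x]; it is transitive because
   H a c - H a b - H b c is always 0 or 1.

   Countably many arcs of leaves of F- separate enough leaves to define a
   monotone real function on the leaves whose image has no gaps inside its
   hull, so that the action on the image extends to the line.  An element
   acting trivially on it would fix a leaf of F+, hence by (A1) would contract
   or expand a leaf of F-, on which it would have to be the identity. *)

Set Implicit Arguments.
Unset Strict Implicit.
Unset Printing Implicit Defensive.

Local Open Scope classical_set_scope.
Local Open Scope ring_scope.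

(** * Monodromy on the plane *)

(** The identities satisfied by [H] are those of the integral part: [H a b + H b a] is 0 or -1, and
    the defect of additivity is 0 or 1. With no circle to appeal to, they are proved by moving one
    variable along leaves, since a function constant on the leaves of both foliations is constant.
    The obstacle is the dependence on the base: [H a x] is built as a function of [x], and its
    behaviour when [a] moves has to be extracted from the relative positions of pairs of leaves.

    The real coordinate depends on the chosen arcs, which [G] does not preserve, and it may identify
    distinct leaves. The strict order that it induces is nevertheless intrinsic: two leaves have
    different coordinates exactly when a nonempty open set lies between them. This is what lets [G]
    act on the image. Along a leaf of F- the coordinate is strictly increasing, and faithfulness
    rests on that. *)

Lemma interval_ind (R : realType) (Q : R -> R -> Prop) :
  (forall a b c, a <= b -> b <= c -> Q a b -> Q b c -> Q a c) ->
  (forall x, exists2 e : R, 0 < e &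
    forall a b : R, x - e < a -> a <= x -> x <= b -> b < x + e -> Q a b) ->
  forall a b, a <= b -> Q a b.
Proof.
move=> Qtrans Qloc a b ab.
have Qxx x : Q x x by have [e e0 /(_ x x)] := Qloc x; apply; lra.
pose S := [set t | [/\ a <= t, t <= b & Q a t]].
have Sa : S a by split.
have ubS : has_ubound S by exists b => t [].
have hS : has_sup S by split => //; exists a.
have as_ : a <= sup S by apply: ub_le_sup.
have sb : sup S <= b by apply: ge_sup => [|t []//]; exists a.
have [e e0 He] := Qloc (sup S).
have [t [at_ tb Qat] tS] := sup_adherent e0 hS.
have ts : t <= sup S by apply: ub_le_sup => //; split.
pose u := Num.min b (sup S + e / 2).
have su : sup S <= u by rewrite le_min sb; lra.
have ue : u < sup S + e by rewrite gt_min; apply/orP; right; lra.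
have Qau : Q a u by apply: (Qtrans _ t) => //; [exact: le_trans su|exact: He].
have Su : S u by split => //; [exact: (le_trans as_)|rewrite ge_min lexx].
have us : u <= sup S by apply: ub_le_sup.
have [bu|ub] := leP b (sup S + e / 2); first by move: Qau; rewrite /u min_l.
move: us; rewrite /u min_r ?(ltW ub) //; lra.
Qed.

Lemma connected_clopen (T : topologicalType) (A : set T) (x : T) :
  connected [set: T] -> open A -> closed A -> A x -> A = [set: T].
Proof.
move=> conn oA cA Ax; apply: conn; first by exists x.
- by exists A => //; rewrite setTI.
- by exists A => //; rewrite setTI.
Qed.

Lemma connected_eq_const (T : topologicalType) (X : Type) (C : set T)
    (F : T -> X) :
  connected C ->
  (forall z, C z -> \forall w \near z, C w -> F w = F z) ->
  forall z w, C z -> C w -> F w = F z.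
Proof.
move=> Cconn Floc z w Cz Cw.
suff /seteqP[_ sub] : [set w | C w /\ F w = F z] = C by case: (sub w Cw).
apply: Cconn; first by exists z.
- exists ([set w | C w -> F w = F z]°); first exact: open_interior.
  apply/seteqP; split=> y /=.
    move=> [Cy Fy]; split=> //; have := Floc y Cy; apply: filterS => v Hv Cv.
    by rewrite Hv.
  by move=> [Cy /nbhs_singleton]; split=> //; auto.
- exists (~` [set w | C w -> F w <> F z]°).
    by rewrite closedC; exact: open_interior.
  apply/seteqP; split=> y /=.
    by move=> [Cy Fy]; split=> // /nbhs_singleton /(_ Cy).
  move=> [Cy nFy]; split=> //; apply: contrapT => Fy; apply: nFy.
  have := Floc y Cy; apply: filterS => v Hv Cv; rewrite Hv //.
Qed.

Lemma nbhs_boxP (R : realType) (z : R * R) (A : set (R * R)) :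
  nbhs z A <-> exists2 e : R, 0 < e &
    forall w, `|z.1 - w.1| < e -> `|z.2 - w.2| < e -> A w.
Proof.
apply: (iff_trans (@nbhs_ballP R (R * R)%type z A)); split=> -[e e0 He];
  exists e => // w.
  by move=> h1 h2; apply: He; split; rewrite -ball_normE.
by move=> []; rewrite -!ball_normE; exact: He.
Qed.

Lemma nbhs_distP (R : realType) (r : R) (A : set R) :
  nbhs r A <-> exists2 d : R, 0 < d & forall q, `|r - q| < d -> A q.
Proof.
apply: (iff_trans (@nbhs_ballP R R r A)); by split=> -[d d0 dA]; exists d.
Qed.

Lemma continuous_pairr (X Y : topologicalType) (x : X) :
  continuous (fun y : Y => (x, y)).
Proof. by move=> y; apply: (cvg_pair (G := nbhs x));
  [exact: cvg_cst|exact: cvg_id]. Qed.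

Lemma continuous_pairl (X Y : topologicalType) (y : Y) :
  continuous (fun x : X => (x, y)).
Proof. by move=> x; apply: (cvg_pair (H := nbhs y));
  [exact: cvg_id|exact: cvg_cst]. Qed.

Section monodromy.
Variable (R : realType).

Definition rect (a b c d : R) : set (R * R) :=
  [set w | a <= w.1 <= b /\ c <= w.2 <= d].

Lemma rect_setX a b c d : rect a b c d = `[a, b]%classic `*` `[c, d]%classic.
Proof. by apply/seteqP; split=> w; rewrite /rect /= !in_itv. Qed.

Lemma compact_rect a b c d : compact (rect a b c d).
Proof. by rewrite rect_setX; apply: compact_setX; exact: segment_compact. Qed.

Lemma closed_rect a b c d : closed (rect a b c d).
Proof.
apply: compact_closed; [exact: norm_hausdorff|exact: compact_rect].
Qed.

Lemma connected_rect a b c d : connected (rect a b c d).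
Proof.
have [->|/set0P[[x0 y0] [/= x0ab y0cd]]] := eqVneq (rect a b c d) set0.
  exact: connected0.
have -> : rect a b c d =
  \bigcup_(x in [set x | a <= x <= b])
     ((fun y => (x, y)) @` `[c, d] `|` (fun x => (x, y0)) @` `[a, b]).
  apply/seteqP; split=> [[x y] [/= xab ycd]|w [x xab]].
    by exists x => //; left; exists y => //=; rewrite in_itv.
  by case=> -[y /=]; rewrite in_itv /= => ycd <-.
apply: bigcup_connected.
  exists (x0, y0) => x xab; right; exists x0 => //=; by rewrite in_itv.
move=> x xab; apply: connectedU.
- exists (x, y0); split; first by exists y0 => //=; rewrite in_itv.
  by exists x => //=; rewrite in_itv.
- apply: connected_continuous_connected; first exact: segment_connected.
  apply: continuous_subspaceT; exact: continuous_pairr.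
- apply: connected_continuous_connected; first exact: segment_connected.
  apply: continuous_subspaceT; exact: continuous_pairl.
Qed.

Lemma connected_plane : connected [set: R * R].
Proof.
have -> : [set: R * R] =
   \bigcup_(r in [set r : R | 0 <= r]) rect (- r) r (- r) r.
  apply/seteqP; split=> // -[x y] _.
  exists (`|x| + `|y|); first by rewrite /=; apply: addr_ge0.
  rewrite /rect /= -!ler_norml; split; by rewrite ?lerDl ?lerDr.
apply: bigcup_connected; last by move=> *; exact: connected_rect.
exists (0, 0) => r /= r0; rewrite /rect /=; split; lra.
Qed.

(** [k z w] is the increment prescribed from [z] to a nearby [w], meaningful for [z] in the
    neighbourhood [U z]. It need not be antisymmetric, so that a primitive may jump on reaching a
    closed set. *)
Variables (U : R * R -> set (R * R)) (k : R * R -> R * R -> int).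
Hypothesis nbhsU : forall z, nbhs z (U z).
Hypothesis kD : forall z y, U z y -> \forall w \near y, k z w = k z y + k y w.

Let good (A : set (R * R)) := exists h : R * R -> int,
  forall z, A z -> \forall w \near z, A w -> h w = h z + k z w.

(** The difference of the two primitives is locally constant on the connected intersection, hence a
    constant [d] there; the second primitive is shifted by [d]. Closedness gives a point of only one
    of the sets a neighbourhood that misses the other. *)
Lemma good_setU A B : closed A -> closed B -> connected (A `&` B) ->
  good A -> good B -> good (A `|` B).
Proof.
move=> cA cB conn [h1 H1] [h2 H2].
have [d Hd] : exists d, forall w, A w -> B w -> h1 w = h2 w + d.
  have [AB0|/set0P[z0 [Az0 Bz0]]] := eqVneq (A `&` B) set0.
    exists 0 => w Aw Bw; suff : (A `&` B) w by rewrite AB0.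
    by [].
  exists (h1 z0 - h2 z0) => w Aw Bw.
  suff : h1 w - h2 w = h1 z0 - h2 z0 by lia.
  apply: (connected_eq_const (F := fun w => h1 w - h2 w) conn) => //.
  move=> z [Az Bz]; near=> v => -[Av Bv].
  have -> : h1 v = h1 z + k z v by move: Av; near: v; exact: H1.
  have -> : h2 v = h2 z + k z v by move: Bv; near: v; exact: H2.
  lia.
exists (fun w => if `[< A w >] then h1 w else h2 w + d) => z ABz.
have nA : ~ A z -> \forall w \near z, ~ A w.
  by move=> nAz; apply: (open_nbhs_nbhs (A := ~` A)); split=> //;
    exact: closed_openC.
have nB : ~ B z -> \forall w \near z, ~ B w.
  by move=> nBz; apply: (open_nbhs_nbhs (A := ~` B)); split=> //;
    exact: closed_openC.
have [Az|Az] := asboolP (A z); have [Bz|Bz] := pselect (B z).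
- have := H1 z Az; have := H2 z Bz; apply: filterS2 => w Bw Aw ABw.
  have [Aw'|Aw'] := asboolP (A w); first by rewrite Aw.
  by rewrite Bw ?(Hd z) //; [lia|case: ABw].
- have := H1 z Az; have := nB Bz; apply: filterS2 => w Bw Aw [Aw'|//].
  by rewrite asboolT // Aw.
- have := H2 z Bz; have := nA Az; apply: filterS2 => w Aw Bw [//|Bw'].
  by rewrite asboolF // Bw //; lia.
- by case: ABz.
Unshelve. all: by end_near. Qed.

(** Two nested interval inductions: small rectangles are stacked inside a thin vertical strip, then
    strips are put side by side. Consecutive pieces meet in a segment, which is connected. *)
Lemma good_rect a b c d : a <= b -> c <= d -> good (rect a b c d).
Proof.
move=> ab cd.
pose Q x c d := exists2 e : R, 0 < e & forall a b : R,
  x - e < a -> a <= x -> x <= b -> b < x + e -> good (rect a b c d).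
have Qall x c' d' : c' <= d' -> Q x c' d'.
  apply: (interval_ind (Q :=
    Q x)) => {c' d'} [c1 c2 c3 c12 c23 [e1 e10 H1] [e2 e20 H2]|y].
    exists (Num.min e1 e2); first by rewrite lt_min e10.
    move=> a' b'; rewrite ltrBlDr => ha a'x xb' hb.
    have -> : rect a' b' c1 c3 = rect a' b' c1 c2 `|` rect a' b' c2 c3.
      apply/seteqP; split=> w; rewrite /rect /=.
        move=> [h /andP[h1 h3]]; have [h2|h2] := leP w.2 c2; [left|right];
          split=> //; lra.
      by case=> -[h /andP[h1 h3]]; split=> //; lra.
    have [m1 m2] : Num.min e1 e2 <= e1 /\ Num.min e1 e2 <= e2 by
      rewrite !ge_min !lexx orbT.
    apply: good_setU; try exact: closed_rect.
    - have -> : rect a' b' c1 c2 `&` rect a' b' c2 c3 = rect a' b' c2 c2.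
        apply/seteqP; split=> w; rewrite /rect /=;
          first by move=> [[h /andP[h1 h2]] [_ /andP[h3 h4]]]; split=> //; lra.
        by move=> [h /andP[h1 h2]]; split; split=> //; lra.
      exact: connected_rect.
    - by apply: H1 => //; lra.
    - by apply: H2 => //; lra.
  have [e e0 He] := (nbhs_boxP _ _).1 (nbhsU (x, y)).
  exists e => // c1 d1 h1 h2 h3 h4; exists e => // a1 b1 h5 h6 h7 h8.
  exists (k (x, y)) => z [/= zx zy].
  have Uz : U (x, y) z by apply: He => /=; rewrite ltr_norml; lra.
  by have := kD Uz; apply: filterS.
apply: (interval_ind (Q := fun a b =>
  good (rect a b c d))) ab => [c1 c2 c3 c12 c23 g1 g2|x].
  have -> : rect c1 c3 c d = rect c1 c2 c d `|` rect c2 c3 c d.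
    apply/seteqP; split=> w; rewrite /rect /=.
      move=> [/andP[h1 h3] h]; have [h2|h2] := leP w.1 c2; [left|right];
        split=> //; lra.
    by case=> -[/andP[h1 h3] h]; split=> //; lra.
  apply: good_setU; try exact: closed_rect; try done.
  have -> : rect c1 c2 c d `&` rect c2 c3 c d = rect c2 c2 c d.
    apply/seteqP; split=> w; rewrite /rect /=;
      first by move=> [[/andP[h1 h2] h] [/andP[h3 h4] _]]; split=> //; lra.
    by move=> [/andP[h1 h2] h]; split; split=> //; lra.
  exact: connected_rect.
exact: (Qall x c d cd).
Qed.

(** Primitives on larger and larger squares, normalized at the origin, agree where they are both
    defined. The strict bound defining [N w] puts [w] in the interior of its square, so that one
    square serves a whole neighbourhood. *)
Lemma monodromy_plane :
  exists h : R * R -> int, forall z, \forall w \near z, h w = h z + k z w.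
Proof.
pose sq (n : nat) := rect (- n%:R) n%:R (- n%:R) n%:R.
have n0 (n : nat) : 0 <= n%:R :> R by exact: ler0n.
have sq0 n : sq n (0, 0) by rewrite /sq /rect /=; have := n0 n; split; lra.
have H n : exists h : R * R -> int, h (0, 0) = 0 /\
    forall z, sq n z -> \forall w \near z, sq n w -> h w = h z + k z w.
  have [||h hP] := @good_rect (- n%:R) n%:R (- n%:R) n%:R; try (have := n0 n;
    lra).
  exists (fun w => h w - h (0, 0)); split; first lia.
  by move=> z /hP; apply: filterS => w hw Aw; rewrite hw //; lia.
have [h hP] := choice H.
have agree n m w : (n <= m)%N -> sq n w -> h n w = h m w.
  move=> nm sqw; apply/eqP; rewrite -subr_eq0; apply/eqP.
  have <- : h n (0, 0) - h m (0, 0) = 0 by rewrite (hP n).1 (hP m).1.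
  have sub : sq n `<=` sq m.
    have nmR : n%:R <= m%:R :> R by rewrite ler_nat.
    by move=> v [/andP[? ?] /andP[? ?]]; split; lra.
  apply: (connected_eq_const (F := fun w =>
    h n w - h m w) (@connected_rect _ _ _ _)) (sq0 n) sqw.
  move=> z sqz; have := (hP n).2 z sqz; have := (hP m).2 z (sub _ sqz).
  by apply: filterS2 => v hm hn sqv; rewrite hm ?hn //; [lia|exact: sub].
pose N (w : R * R) := Num.bound (`|w.1| + `|w.2|).
have sqN w n : `|w.1| + `|w.2| < n%:R -> sq n w.
  have := normr_ge0 w.1; have := normr_ge0 w.2 => h1 h2 h3.
  by rewrite /sq /rect /= -!ler_norml; split; lra.
have NP w : `|w.1| + `|w.2| < (N w)%:R by apply: archi_boundP; exact: addr_ge0.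
have hN w n : sq n w -> h (N w) w = h n w.
  move=> sqw; have [nm|nm] := leqP (N w) n; first exact/agree/sqN.
  by apply/esym/agree => //; exact: ltnW.
exists (fun w => h (N w) w) => z.
have /(hP (N z)).2 := sqN _ _ (NP z).
suff : \forall w \near z, sq (N z) w.
  by apply: filterS2 => w sqw hw; rewrite (hN _ _ sqw) hw.
apply/nbhs_boxP; have := NP z; set r : R := (N z)%:R => hr.
exists ((r - (`|z.1| + `|z.2|)) / 2); first lra.
move=> w h1 h2; apply: sqN; rewrite -/r.
have := ler_normB (z.1 - w.1) z.1; have := ler_normB (z.2 - w.2) z.2.
rewrite addrAC subrr add0r normrN addrAC subrr add0r normrN; lra.
Qed.

End monodromy.

(** * Leaves and charts *)

Section plane.
Variables (R : realType) (P : topologicalType).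

Definition is_plane := exists (phi : P -> R * R) (g : R * R -> P),
  [/\ continuous phi, continuous g, cancel phi g & cancel g phi].

Hypothesis planeP : is_plane.

Lemma plane_hausdorff : hausdorff_space P.
Proof.
have [phi [g [cphi cg phiK gK]]] := planeP => x y xy.
rewrite -(phiK x) -(phiK y); congr g.
apply: (@norm_hausdorff _ (R * R)%type) => A B Ax By.
have [z [Az Bz]] := xy _ _ (cphi x _ Ax) (cphi y _ By).
by exists (phi z).
Qed.

Lemma plane_connected : connected [set: P].
Proof.
have [phi [g [cphi cg phiK gK]]] := planeP.
have -> : [set: P] = g @` [set: R * R].
  by apply/esym; rewrite -subTset => x _; exists (phi x).
apply: connected_continuous_connected; first exact: connected_plane.
exact: continuous_subspaceT.
Qed.

Lemma plane_compact_nbhs (x : P) : exists2 K : set P, compact K & nbhs x K.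
Proof.
have [phi [g [cphi cg phiK gK]]] := planeP.
pose r := rect ((phi x).1 - 1) ((phi x).1 + 1) ((phi x).2 - 1) ((phi x).2 + 1).
exists (phi @^-1` r).
  have -> : phi @^-1` r = g @` r.
    apply/seteqP; split=> y /=; first by exists (phi y).
    by move=> [w rw <-]; rewrite gK.
  apply: continuous_compact; last exact: compact_rect.
  exact: continuous_subspaceT.
apply: cphi; apply/nbhs_boxP; exists 1 => // w.
by rewrite !ltr_distlC => /andP[? ?] /andP[? ?]; split; lra.
Qed.

Lemma monodromy (U : P -> set P) (k : P -> P -> int) :
  (forall z, nbhs z (U z)) ->
  (forall z y, U z y -> \forall w \near y, k z w = k z y + k y w) ->
  exists h : P -> int, forall z, \forall w \near z, h w = h z + k z w.
Proof.
have [phi [g [cphi cg phiK gK]]] := planeP => nU kD.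
have [||h hP] := @monodromy_plane R (fun z => g @^-1` (U (g z)))
    (fun z w => k (g z) (g w)).
- by move=> z; apply: cg; exact: nU.
- by move=> z y Uzy; exact: (cg y _ (kD _ _ Uzy)).
exists (fun w => h (phi w)) => z.
have : \forall w \near z, h (phi w) = h (phi z) + k (g (phi z)) (g (phi w)).
  exact: (cphi z _ (hP (phi z))).
by apply: filterS => w; rewrite !phiK.
Qed.

(** A limit point of the image has a compact neighbourhood, and properness confines the parameters
    that reach it to a compact set. *)
Lemma plane_proper_closed (c : R -> P) : continuous c ->
  (forall K : set P, compact K -> compact (c @^-1` K)) ->
  forall C : set R, closed C -> closed (c @` C).
Proof.
move=> cc cK C cC x clx.
have [K Kc Kx] := plane_compact_nbhs x.
have : compact (c @` (c @^-1` K `&` C)).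
  apply: continuous_compact; first exact: continuous_subspaceT.
  by apply: compact_closedI => //; exact: cK.
move=> /(compact_closed plane_hausdorff) /(_ x).
suff : closure (c @` (c @^-1` K `&` C)) x.
  by move=> h /(_ h) [r [_ Cr] <-]; exists r.
move=> V Vx; have [_ [[r Cr <-] [Kr Vr]]] := clx _ (filterI Kx Vx).
by exists (c r); split=> //; exists r.
Qed.

End plane.

Section lines.
Variables (R : realType) (P : topologicalType) (prec : P -> P -> Prop).

(** Only the order along leaves is kept: the leaf of [x] is recovered as the set of points
    comparable with [x], and proper embedding survives as the fact that parametrizations are closed
    maps. *)
Definition oriented_lines := forall x : P, exists c : R -> P,
  [/\ continuous c, (forall C, closed C -> closed (c @` C)),
      (exists r, c r = x), (forall s t, prec (c s) (c t) <-> s < t)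
    & forall s y, prec (c s) y \/ prec y (c s) -> exists t, c t = y].

Definition lf (x : P) : set P := [set y | [\/ y = x, prec x y | prec y x]].

Lemma lf_path (tau : R -> P) s t :
  (forall s t, prec (tau s) (tau t) <-> s < t) -> lf (tau s) (tau t).
Proof.
move=> tauP; have [h|h|->] := ltgtP s t; last exact: Or31.
  exact/Or32/tauP.
exact/Or33/tauP.
Qed.

Hypothesis linesP : oriented_lines.

Lemma prec_irr x : ~ prec x x.
Proof.
by have [c [_ _ [r <-] cP _]] := linesP x; rewrite cP ltxx.
Qed.

Lemma prec_trans x y z : prec x y -> prec y z -> prec x z.
Proof.
have [c [_ _ [r <-] cP cR]] := linesP y => xy yz.
have [s sx] := cR r x (or_intror xy); have [t tz] := cR r z (or_introl yz).
by move: xy yz; rewrite -sx -tz !cP; exact: lt_trans.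
Qed.

Lemma prec_asym x y : prec x y -> ~ prec y x.
Proof. by move=> xy yx; apply: (@prec_irr x); exact: prec_trans yx. Qed.

Lemma lf_refl x : lf x x. Proof. exact: Or31. Qed.

Lemma lf_line x : exists c : R -> P,
  [/\ continuous c, (forall C, closed C -> closed (c @` C)),
      range c = lf x & forall s t, prec (c s) (c t) <-> s < t].
Proof.
have [c [cc cl [r cr] cP cR]] := linesP x; exists c; split=> //.
apply/seteqP; split=> [_ [s _ <-]|y].
  by rewrite -cr; exact: lf_path.
rewrite -cr /lf /= => -[->|h|h]; first by exists r.
  by have [t <-] := cR _ _ (or_introl h); exists t.
by have [t <-] := cR _ _ (or_intror h); exists t.
Qed.

Lemma line_inj (c : R -> P) :
  (forall s t, prec (c s) (c t) <-> s < t) -> injective c.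
Proof.
move=> cP s t st; have [h|h|//] := ltgtP s t.
  by have := (cP s t).2 h; rewrite st => /prec_irr.
by have := (cP t s).2 h; rewrite st => /prec_irr.
Qed.

Lemma lf_sym x y : lf x y -> lf y x.
Proof. by case=> [->|h|h]; [exact: Or31|exact: Or33|exact: Or32]. Qed.

Lemma lf_trans x y z : lf x y -> lf y z -> lf x z.
Proof.
have [c [_ _ rc cP]] := lf_line y => /lf_sym yx yz.
have : range c x by rewrite rc. have : range c z by rewrite rc.
by move=> [s _ <-] [t _ <-]; exact: lf_path.
Qed.

Lemma lf_eq x y : lf x y -> lf x = lf y.
Proof.
move=> xy; apply/seteqP; split=> z; first exact/lf_trans/lf_sym.
exact: lf_trans.
Qed.

Lemma lf_closed x : closed (lf x).
Proof. by have [c [_ cl <- _]] := lf_line x; apply: cl; exact: closedT. Qed.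

Lemma lf_connected x : connected (lf x).
Proof.
have [c [cc _ <- _]] := lf_line x.
apply: connected_continuous_connected; last exact: continuous_subspaceT.
by apply/connected_intervalP => a b.
Qed.

Lemma lf_next x : exists y, prec x y.
Proof.
have [c [cc _ rc cP]] := lf_line x.
have [r _ <-] : range c x by rewrite rc; exact: lf_refl.
by exists (c (r + 1)); rewrite cP ltrDl.
Qed.

Lemma lf_prev x : exists y, prec y x.
Proof.
have [c [cc _ rc cP]] := lf_line x.
have [r _ <-] : range c x by rewrite rc; exact: lf_refl.
by exists (c (r - 1)); rewrite cP gtrBl.
Qed.

Section increasing_path.
Variable tau : R -> P.
Hypothesis tauc : continuous tau.
Hypothesis tauP : forall s t, prec (tau s) (tau t) <-> s < t.

(** If [u] were missed, the parameters whose image is at or before [u] and those whose image is at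
    or after [u] would split the real line into two nonempty closed sets. *)
Lemma path_between t1 t2 u : prec (tau t1) u -> prec u (tau t2) ->
  exists t, tau t = u.
Proof.
move=> t1u ut2; apply: contrapT => nu.
have [c [cc cl rc cP]] := lf_line u.
have [r _ ru] : range c u by rewrite rc; exact: lf_refl.
have lft t : lf u (tau t).
  by apply: lf_trans (lf_path t1 t tauP); exact: Or33.
pose A := tau @^-1` (c @` [set s | s <= r]).
have cA : closed A by apply: preimage_closed => [x _|];
  [exact: tauc|exact/cl/closed_le].
have AC : ~` A = tau @^-1` (c @` [set s | r <= s]).
  apply/seteqP; split=> t /=.
    have : range c (tau t) by rewrite rc; exact: lft.
    move=> [s _ st] ns; exists s => //=; rewrite leNgt; apply/negP => sr.
    by apply: ns; exists s => //=; exact: ltW.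
  move=> [s /= rs st] [s' /= s'r s't].
  have ss : s = s' by apply: (line_inj cP); rewrite st.
  by apply: nu; exists t; rewrite -ru -st; congr c; apply/le_anti;
    rewrite {1}ss s'r.
have oA : open A.
  rewrite -closedC AC; apply: preimage_closed => [x _|];
    [exact: tauc|exact/cl/closed_ge].
have : A = setT.
  apply: (@connected_clopen _ A t1) => //;
    first by apply/connected_intervalP => a b.
  have [s _ st] : range c (tau t1) by rewrite rc; exact: lft.
  by exists s => //=; move: t1u; rewrite -st -ru cP => /ltW.
move=> AT; have : A t2 by rewrite AT.
move=> [s /= sr st]; move: ut2; rewrite -st -ru cP; lra.
Qed.

(** Proper embedding acts here: the part of the leaf outside an arc around [tau t] is closed, so the
    leaf does not accumulate on [tau t] from elsewhere. *)
Lemma path_nbhs t : exists2 V, nbhs (tau t) V &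
  forall y, V y -> lf (tau t) y -> exists t', tau t' = y.
Proof.
have [c [cc cl rc cP]] := lf_line (tau t).
have cover y : lf (tau t) y -> exists s, c s = y.
  by rewrite -rc => -[s _ <-]; exists s.
have [r1 e1] : exists r1, c r1 = tau (t - 1).
  by apply: cover; apply: Or33; rewrite tauP; lra.
have [r2 e2] : exists r2, c r2 = tau (t + 1).
  by apply: cover; apply: Or32; rewrite tauP; lra.
have [r e] := cover _ (lf_refl _).
have r1r : r1 < r by rewrite -cP e1 e tauP; lra.
have rr2 : r < r2 by rewrite -cP e2 e tauP; lra.
exists (~` (c @` ([set s | s <= r1] `|` [set s | r2 <= s]))).
  apply: open_nbhs_nbhs; split.
    by apply: closed_openC; apply: cl; apply: closedU;
      [exact: closed_le|exact: closed_ge].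
  move=> [s /= h]; rewrite -e => /(line_inj cP) sr.
  by move: h; rewrite sr; case; rewrite leNgt ?r1r ?rr2.
move=> y Vy /cover [s sy]; apply: (@path_between (t - 1) (t + 1)).
  by rewrite -e1 -sy cP ltNge; apply/negP => h; apply: Vy; exists s => //; left.
by rewrite -e2 -sy cP ltNge; apply/negP => h; apply: Vy; exists s => //; right.
Qed.

End increasing_path.
End lines.

Section charts.
Variables (R : realType) (P : topologicalType).
Implicit Types (pp pm : P -> P -> Prop) (psi : R * R -> P).

(** [psi] is the inverse of a chart onto the whole of [R * R], which spares any bookkeeping of
    domains. *)
Record box_chart pp pm psi : Prop := {
  chart_continuous : continuous psi;
  chart_open : forall O, open O -> open (psi @` O);
  chart_inj : injective psi;
  chart_p : forall s s' t, pp (psi (s, t)) (psi (s', t)) <-> s < s';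
  chart_m : forall s t t', pm (psi (s, t)) (psi (s, t')) <-> t < t' }.

Record bifoliation pp pm : Prop := {
  bif_plane : is_plane R P;
  bif_p : oriented_lines R pp;
  bif_m : oriented_lines R pm;
  bif_chart : forall x, exists psi p, box_chart pp pm psi /\ psi p = x }.

Definition swap (X Y : Type) (z : X * Y) := (z.2, z.1).

Lemma swap_continuous (X Y : topologicalType) : continuous (@swap X Y).
Proof.
by move=> -[x y]; apply: (cvg_pair (G := nbhs y) (H := nbhs x));
  [exact: cvg_snd|exact: cvg_fst].
Qed.

Lemma box_chart_swap pp pm psi :
  box_chart pp pm psi -> box_chart pm pp (psi \o @swap R R).
Proof.
move=> [cpsi opsi ipsi hp hm]; split=> //.
- by move=> z; apply: continuous_comp; [exact: swap_continuous|exact: cpsi].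
- move=> O oO; rewrite -(image_comp (@swap R R) psi); apply: opsi.
  have -> : @swap R R @` O = @swap R R @^-1` O.
    apply/seteqP; split=> z /=; first by move=> [w Ow <-]; case: w Ow.
    by move=> Oz; exists (swap z) => //; case: z Oz.
  by apply: open_comp => // z _; exact: swap_continuous.
- by move=> [a b] [a' b'] /ipsi [-> ->].
- by move=> s s' t; exact: hm.
- by move=> s t t'; exact: hp.
Qed.

(** Statements about left and right come for free from those about down and up. The exchange
    reverses the orientation of the plane, to which [bifoliation] is insensitive. *)
Lemma bifoliation_swap pp pm : bifoliation pp pm -> bifoliation pm pp.
Proof.
move=> [hP hp hm hc]; split=> // x.
have [psi [p [h <-]]] := hc x.
exists (psi \o @swap R R), (swap p); split; first exact: box_chart_swap.
by case: p.
Qed.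

Lemma chart_lf_p pp pm psi s s' t : box_chart pp pm psi ->
  lf pp (psi (s, t)) (psi (s', t)).
Proof.
by move=> h; apply: (lf_path (tau := fun s => psi (s, t))) => a b;
  exact: chart_p h _ _ _.
Qed.

Lemma chart_lf_m pp pm psi s t t' : box_chart pp pm psi ->
  lf pm (psi (s, t)) (psi (s, t')).
Proof.
by move=> h; apply: (lf_path (tau := fun t => psi (s, t))) => a b;
  exact: chart_m h _ _ _.
Qed.

Lemma chart_nbhs pp pm psi p O : box_chart pp pm psi ->
  nbhs p O -> nbhs (psi p) (psi @` O).
Proof.
move=> h Op; have : nbhs (psi p) (psi @` O°).
  apply: open_nbhs_nbhs; split; last by exists p.
  by apply: chart_open h _ _; exact: open_interior.
by apply: filterS; apply: image_subset; exact: interior_subset.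
Qed.

Lemma chart_nbhs_range pp pm psi p : box_chart pp pm psi ->
  nbhs (psi p) (range psi).
Proof. by move=> h; apply: chart_nbhs h _; exact: filterT. Qed.

End charts.

Section corners.
Variables (R : realType) (P : topologicalType) (pp pm : P -> P -> Prop).
Hypothesis bif : bifoliation R pp pm.
Implicit Types psi : R * R -> P.

Lemma chart_nbhs_m psi p : box_chart pp pm psi ->
  exists2 V, nbhs (psi p) V &
  forall y, V y -> lf pm (psi p) y -> exists t, psi (p.1, t) = y.
Proof.
case: p => s t h.
apply: (path_nbhs (bif_m bif) (tau := fun t => psi (s, t))) => [u|u v].
  apply: (continuous_comp (g := psi));
    [exact: continuous_pairr|exact: chart_continuous h _].
exact: chart_m h _ _ _.
Qed.

Lemma chart_between_m psi s t1 t2 u : box_chart pp pm psi ->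
  pm (psi (s, t1)) u -> pm u (psi (s, t2)) -> exists t, psi (s, t) = u.
Proof.
move=> h; apply: (path_between (bif_m bif) (tau := fun t => psi (s,
  t))) => [a|a b].
  apply: (continuous_comp (g := psi));
    [exact: continuous_pairr|exact: chart_continuous h _].
exact: chart_m h _ _ _.
Qed.

(** Near each of its points a [pm]-leaf is a single plaque of the second chart, so the abscissa
    there is locally constant; interval induction joins the pieces. *)
Lemma chart_same_m psi1 psi2 s t t' :
  box_chart pp pm psi1 -> box_chart pp pm psi2 -> t <= t' ->
  (forall r, t <= r <= t' -> range psi2 (psi1 (s, r))) ->
  exists s2 r r', psi1 (s, t) = psi2 (s2, r) /\ psi1 (s, t') = psi2 (s2, r').
Proof.
move=> h1 h2 tt' sub.
suff : t <= t -> t' <= t' ->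
  exists s2 r r', psi1 (s, t) = psi2 (s2, r) /\ psi1 (s, t') = psi2 (s2, r').
  exact.
apply: (interval_ind (Q := fun a b => t <= a -> b <= t' ->
  exists s2 r r', psi1 (s, a) = psi2 (s2, r) /\ psi1 (s, b) = psi2 (s2,
    r'))) tt' => [a b c ab bc Qab Qbc ta ct|r].
  have [||s2 [r [r' [e1 e2]]]] := Qab _ _; [by []|exact: le_trans ct|].
  have [||s3 [q [q' [e3 e4]]]] := Qbc _ _; [exact: le_trans ab|by []|].
  exists s2, r, q'; split=> //.
  by move: e2; rewrite e3 => /(chart_inj h2) [<- _].
have [tr|tr] := pselect (t <= r <= t'); last first.
  by exists 1 => // a b _ ar rb _ ta bt; exfalso; apply: tr; lra.
have [[s2 r2] _ e] := sub r tr.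
have [V Vn VP] := chart_nbhs_m (s2, r2) h2.
have : nbhs r ((fun r => psi1 (s, r)) @^-1` V).
  apply: (continuous_comp (f := fun r => (s, r)) (g := psi1)).
  - exact: continuous_pairr.
  - exact: chart_continuous h1 _.
  - by rewrite /= -e.
move=> /nbhs_distP [d d0 dV]; exists d => // a b da ar rb bd ta bt.
have Va q : `|r - q| < d -> exists r', psi1 (s, q) = psi2 (s2, r').
  move=> qr; have [||r' <-] := VP (psi1 (s, q)); last by exists r'.
    exact: dV.
  by rewrite e; exact: chart_lf_m h1.
have [|ra ea] := Va a _; first by rewrite ltr_distlC; lra.
have [|rb' eb] := Va b _; first by rewrite ltr_distlC; lra.
by exists s2, ra, rb'.
Qed.

End corners.

Section corner.
Variables (R : realType) (P : topologicalType) (pp pm : P -> P -> Prop).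
Hypothesis bif : bifoliation R pp pm.
Implicit Types psi : R * R -> P.

Lemma chart_same_p psi1 psi2 s s' t :
  box_chart pp pm psi1 -> box_chart pp pm psi2 -> s <= s' ->
  (forall r, s <= r <= s' -> range psi2 (psi1 (r, t))) ->
  exists t2 r r', psi1 (s, t) = psi2 (r, t2) /\ psi1 (s', t) = psi2 (r', t2).
Proof.
move=> h1 h2 ss sub.
apply: (chart_same_m (bifoliation_swap bif) (box_chart_swap h1) (box_chart_swap
  h2)) ss _ => r rs.
by have [p _ e] := sub r rs; exists (swap p) => //=; rewrite -e; case: p {e}.
Qed.

(* Near a common point, both charts decompose a small displacement into a
   move along pp-leaves followed by the same move along pm-leaves. *)
Lemma chart_corner psi1 psi2 p1 p2 :
  box_chart pp pm psi1 -> box_chart pp pm psi2 -> psi1 p1 = psi2 p2 ->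
  \forall w \near psi1 p1, exists s1 t1 s2 t2,
    [/\ w = psi1 (s1, t1), w = psi2 (s2, t2)
      & psi1 (s1, p1.2) = psi2 (s2, p2.2)].
Proof.
move=> h1 h2 e.
have : nbhs p1 (psi1 @^-1` range psi2).
  have := chart_nbhs_range p2 h2; rewrite -e; exact: (chart_continuous h1).
move=> /nbhs_boxP [d d0 dsub].
have := chart_nbhs h1 ((nbhs_boxP p1 [set w | `|p1.1 - w.1| < d /\ `|p1.2 -
  w.2| < d]).2
   (ex_intro2 _ _ d d0 (fun w a b => conj a b))).
apply: filterS => _ [[s t] /= [sd td] <-].
have sub a b : `|p1.1 - a| < d -> `|p1.2 - b| < d -> range psi2 (psi1 (a, b)).
  by move=> ha hb; apply: dsub.
have [s2 e2] : exists s2, psi1 (s, p1.2) = psi2 (s2, p2.2).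
  move: e sub sd; case: p1 {dsub td} => s1 t1 /= e sub sd.
  have tt : `|t1 - t1| < d by rewrite subrr normr0.
  have [ss|ss] := leP s1 s.
    have [|t2 [r [r' [e1 e2]]]] := chart_same_p h1 h2 ss (t := t1).
      by move=> r hr; apply: sub => //; move: sd; rewrite !ltr_distlC; lra.
    by exists r'; rewrite e2; move: e1; rewrite e => /(chart_inj h2) ->.
  have [|t2 [r [r' [e1 e2]]]] := chart_same_p h1 h2 (ltW ss) (t := t1).
    by move=> r hr; apply: sub => //; move: sd; rewrite !ltr_distlC; lra.
  by exists r; rewrite e1; move: e2; rewrite e => /(chart_inj h2) ->.
exists s, t, s2.
suff [r er] : exists r, psi1 (s, t) = psi2 (s2, r) by exists r.
have [tt|tt] := leP p1.2 t.
  have [|s3 [r [r' [e3 e4]]]] := chart_same_m bif h1 h2 tt (s := s).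
    by move=> r hr; apply: sub => //; move: td; rewrite !ltr_distlC; lra.
  by exists r'; rewrite e4; move: e3; rewrite e2 => /(chart_inj h2) [-> _].
have [|s3 [r [r' [e3 e4]]]] := chart_same_m bif h1 h2 (ltW tt) (s := s).
  by move=> r hr; apply: sub => //; move: td; rewrite !ltr_distlC; lra.
by exists r; rewrite e3; move: e4; rewrite e2 => /(chart_inj h2) [-> _].
Qed.

(** Inside a chart a horizontal and a vertical move join any two points, so [F] is locally constant
    on a connected plane. *)
Lemma leaf_constant (T : Type) (F : P -> T) :
  (forall x y, pp x y -> F x = F y) -> (forall x y, pm x y -> F x = F y) ->
  forall x y, F x = F y.
Proof.
move=> Fp Fm x y; apply/esym.
apply: (connected_eq_const (F :=
  F) (plane_connected (bif_plane bif))) => // z _.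
have [psi [[s0 t0] [h <-]]] := bif_chart bif z.
have := chart_nbhs_range (s0, t0) h; apply: filterS => _ [[s t] _ <-] _.
have {}Fp a b : lf pp a b -> F a = F b.
  by case=> [->|/Fp|/Fp].
have {}Fm a b : lf pm a b -> F a = F b.
  by case=> [->|/Fm|/Fm].
rewrite -(Fm _ _ (chart_lf_m s t0 t h)); apply: Fp; exact: chart_lf_p h.
Qed.

End corner.

(** * Sides of a leaf *)

Section sides.
Variables (P : topologicalType) (pp pm : P -> P -> Prop).

(** The last two fields select, among the two sides of [l], the one that the oriented [pm]-leaves
    enter when they cross [l]. *)
Record upper_side (l A : set P) : Prop := {
  side_open : open A;
  side_compl_open : open (~` (A `|` l));
  side_disj : forall y, A y -> ~ l y;
  side_next : forall y z, l y -> pm y z -> A z;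
  side_prev : forall y z, l y -> pm z y -> ~ (A `|` l) z }.

(** The default [set0] is never taken, since every leaf has an upper side. *)
Definition above (x : P) : set P := xget set0 (upper_side (lf pp x)).
Definition below (x : P) : set P := ~` (above x `|` lf pp x).

End sides.

Section sides_theory.
Variables (R : realType) (P : topologicalType) (pp pm : P -> P -> Prop).
Hypothesis bif : bifoliation R pp pm.
Let linesP := bif_p bif.
Let linesM := bif_m bif.

(** Monodromy stands in for a Jordan separation theorem. The increment is -1 when leaving [l]
    downwards and 0 otherwise; the primitive [h] is then constant on [l], locally constant off [l],
    and smaller just below [l]. The upper side is the set of points off [l] where [h] is at least
    its value on [l]. *)
Lemma upper_side_exists x : exists A, upper_side pm (lf pp x) A.
Proof.
set l := lf pp x.
have lP y z : l y -> lf pp y z -> l z by exact: lf_trans.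
have [psi hpsi] := choice (bif_chart bif).
have [p hp] := choice hpsi.
have ch z : box_chart pp pm (psi z) by case: (hp z).
have pz z : psi z (p z) = z by case: (hp z).
pose lo z w := exists s t, w = psi z (s, t) /\ t < (p z).2.
pose k z w : int := if `[< l z /\ lo z w >] then -1 else 0.
have k0 z w : ~ (l z /\ lo z w) -> k z w = 0 by move=> h; rewrite /k asboolF.
have k1 z w : l z -> lo z w -> k z w = -1 by move=> h h'; rewrite /k asboolT.
have loE z s t : lo z (psi z (s, t)) <-> t < (p z).2.
  split=> [[s' [t' [/(chart_inj (ch z)) [_ ->]]]] //|h].
  by exists s, t.
have kle z w : k z w <= 0 by rewrite /k; case: ifP.
have nbV z : exists V, nbhs z V /\ forall y, V y -> l z -> l y ->
    exists s, psi z (s, (p z).2) = y.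
  have [V Vn VP] :=
    chart_nbhs_m (bifoliation_swap bif) (swap (p z)) (box_chart_swap (ch z)).
  have e : (psi z \o @swap R R) (swap (p z)) = z.
    by rewrite /= -[RHS]pz; case: (p z).
  rewrite e in Vn VP; exists V; split=> // y Vy lz ly.
  have [t <-] := VP y Vy (lf_trans linesP (lf_sym lz) ly); exists t => /=.
  by case: (p z).
have [V hV] := choice nbV.
(* Around a point of [l] the leaf is a single plaque, which makes leaving it downwards meaningful;
   elsewhere the neighbourhood avoids [l]. *)
pose U z := if `[< l z >] then V z `&` range (psi z) else ~` l.
have nU z : nbhs z (U z).
  rewrite /U; have [lz|lz] := asboolP (l z).
    apply: filterI; first by case: (hV z).
    by have := chart_nbhs_range (p z) (ch z); rewrite pz.
  apply: open_nbhs_nbhs; split=> //; apply: closed_openC;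
    exact: lf_closed linesP _.
have nl z : ~ l z -> \forall w \near z, ~ l w.
  move=> lz; apply: open_nbhs_nbhs; split=> //; apply: closed_openC;
    exact: lf_closed linesP _.
have kD z y : U z y -> \forall w \near y, k z w = k z y + k y w.
  rewrite /U; have [lz|lz] := asboolP (l z); last first.
    by move=> ly; apply: filterE => w;
      rewrite (k0 z w) ?(k0 z y) ?(k0 y w) ?addr0 //; case.
  move=> [Vy [[s t] _ e]].
  have [ly|ly] := pselect (l y).
    have [s' e'] := (hV z).2 y Vy lz ly.
    have [_ tp] : (s', (p z).2) = (s, t) by apply: (chart_inj (ch z));
      rewrite e'.
    rewrite (k0 z y); last first.
      by case=> _; rewrite -e loE tp ltxx.
    (* The common corner is at the level of [l] in both charts, so [w] is below it for one chart
       exactly when it is for the other. *)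
    have := chart_corner bif (ch y) (ch z) (etrans (pz y) (esym e)).
    rewrite pz; apply: filterS => w [s1 [t1 [s2 [t2 [e1 e2 e3]]]]].
    have : lo y w <-> lo z w.
      rewrite {1}e1 e2 !loE -(chart_m (ch y) s1) -e1 e3 e2 -tp.
      exact: chart_m (ch z) _ _ _.
    move=> eq; rewrite add0r /k (_ : `[< l z /\ lo z w >] = `[< l y /\ lo y w
      >]) //.
    apply: asbool_equiv_eq.
    by split=> -[_] /eq.
  have tp : t != (p z).2.
    apply/eqP => tp; apply: ly; apply: lP lz _.
    by rewrite -e tp -{1}(pz z); case: (p z) => *; exact: chart_lf_p (ch z).
  have : \forall w \near y, lo z w <-> lo z y.
    have : nbhs (s, t) [set w : R * R | w.2 < (p z).2 <-> t < (p z).2].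
      apply/nbhs_boxP; exists `|t - (p z).2|;
        first by rewrite normr_gt0 subr_eq0.
      move=> [s' t'] /= _; rewrite ltr_distlC.
      by have [h|h|h] := ltgtP t (p z).2;
        [rewrite ltr0_norm ?subr_lt0 //|rewrite gtr0_norm ?subr_gt0 //|rewrite
          h eqxx in tp]; move=> ?; split; lra.
    move=> /(chart_nbhs (ch z)); rewrite e;
      apply: filterS => _ [[s' t'] /= h <-].
    by rewrite -e !loE.
  move=> near_lo; have := near_lo; apply: filterS => w eq.
  rewrite (k0 y w) ?addr0; last by case.
  rewrite /k (_ : `[< l z /\ lo z w >] = `[< l z /\ lo z y >]) //.
  by apply: asbool_equiv_eq; split=> -[_] /eq.
have [h hP] := monodromy (bif_plane bif) nU kD.
have hl y : l y -> h y = h x.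
  move=> ly; have cst := connected_eq_const (F :=
    h) (@lf_connected R P pp linesP x).
  apply: (cst _ x y) => //; last exact: lf_refl.
  move=> z lz; have := hP z; have := (hV z).1; apply: filterS2 => w Vw hw lw.
  have [s e] := (hV z).2 w Vw lz lw.
  by rewrite hw k0 ?addr0 // => -[_]; rewrite -e loE ltxx.
(* From any point of a [pm]-leaf, the increment -1 can only be met backwards. *)
have hm y z : pm y z -> h y <= h z.
  move=> yz; have [c [cc _ rc cP]] := lf_line linesM y.
  have [a _ ay] : range c y by rewrite rc; exact: lf_refl.
  have [b _ bz] : range c z by rewrite rc; exact: Or32.
  have : a <= b by apply: ltW; rewrite -cP ay bz.
  rewrite -ay -bz; apply: (interval_ind (Q := fun a b => h (c a) <= h (c b))).
    by move=> r s t _ _; exact: le_trans.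
  move=> r; have [W Wn WP] := chart_nbhs_m bif (p (c r)) (ch (c r)).
  rewrite pz in Wn WP.
  have : nbhs r (c @^-1` (W `&` [set w | h w = h (c r) + k (c r) w])).
    by apply: cc; apply: filterI => //; exact: hP.
  move=> /nbhs_distP [d d0 dsub]; exists d => // q q' h1 h2 h3 h4.
  have [_ ->] : (c @^-1` (W `&` [set w | h w = h (c r) + k (c r) w])) q.
    by apply: dsub; rewrite ltr_distlC; lra.
  have [Wq ->] : (c @^-1` (W `&` [set w | h w = h (c r) + k (c r) w])) q'.
    by apply: dsub; rewrite ltr_distlC; lra.
  rewrite (k0 _ (c q')) ?lerD2l //.
  move=> [_]; have [|t e] := WP _ Wq; first exact: lf_path.
  rewrite -e loE => tp.
  have : pm (c q') (c r).
    rewrite -e -[X in pm _ X](pz (c r)); case: (p (c r)) tp {e} => u v /= tp.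
    by rewrite (chart_m (ch (c r))).
  by rewrite cP; lra.
have hlt y z : l y -> pm z y -> h z < h y.
  move=> ly zy; have [c [cc _ rc cP]] := lf_line linesM y.
  have [a _ ay] : range c y by rewrite rc; exact: lf_refl.
  have [b _ bz] : range c z by rewrite rc; exact: Or33.
  have [W Wn WP] := chart_nbhs_m bif (p y) (ch y).
  rewrite pz in Wn WP.
  have : nbhs a (c @^-1` (W `&` [set w | h w = h y + k y w])).
    by apply: cc; rewrite ay; apply: filterI => //; exact: hP.
  move=> /nbhs_distP [d d0 dsub].
  have ba : b < a by rewrite -cP ay bz.
  (* [q] is close enough to [a] for the increment from [y] to be known, and still after [b], so that
     monotonicity carries the drop down to [z]. *)
  pose q := Num.max ((a + b) / 2) (a - d / 2).
  have [h1 h2 h3] : [/\ b < q, q < a & a - d < q].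
    by rewrite /q !lt_max gt_max; split; [apply/orP; left|apply/andP;
      split|apply/orP; right]; lra.
  have [Wq hq] : (c @^-1` (W `&` [set w | h w = h y + k y w])) q.
    by apply: dsub; rewrite ltr_distlC; lra.
  have : h z <= h (c q) by apply: hm; rewrite -bz cP.
  rewrite hq k1 //; first lia.
  have [|t e] := WP _ Wq; first by rewrite -ay; exact: lf_path.
  rewrite -e loE -(chart_m (ch y) (p y).1) e -surjective_pairing pz -ay cP //.
exists ([set w | h x <= h w] `\` l); split.
- rewrite openE => z [hz lz]; rewrite /interior.
  have := hP z; have := nl z lz; apply: filterS2 => w lw hw; split=> //=.
  by rewrite hw k0 ?addr0 //; case.
- have -> : ~` ([set w | h x <= h w] `\` l `|` l) = [set w | h w < h x].
    apply/seteqP; split=> w /=.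
      by move=> hw; rewrite ltNge; apply/negP => h'; apply: hw;
        have [lw|lw] := pselect (l w); [right|left].
    by move=> hw [[]|/hl]; lia.
  rewrite openE => z /= hz; rewrite /interior.
  have lz : ~ l z by move/hl; lia.
  by have := hP z; apply: filterS => w /= ->; rewrite k0 ?addr0 //; case.
- by move=> y [].
- move=> y z ly yz; split=> /= [|lz]; first by rewrite -(hl y ly) hm.
  by have := hlt _ _ lz yz; rewrite !hl // ltxx.
- move=> y z ly zy; have := hlt _ _ ly zy;
  rewrite (hl y ly) => hz [[/= ? _]|/hl]; lia.
Qed.

Lemma above_side x : upper_side pm (lf pp x) (above pp pm x).
Proof. by rewrite /above; case: xgetP => // /(_ _) n;
  have [A /n] := upper_side_exists x. Qed.

End sides_theory.

(** Given a separation, the piece that misses [l] is open in the whole space because it lies in [A],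
    and closed because the union is; being disjoint from [l], it is empty. *)
Lemma connected_openU (T : topologicalType) (A l : set T) :
  connected [set: T] -> open A -> connected l -> l !=set0 ->
  (forall y, A y -> ~ l y) -> closed (A `|` l) -> connected (A `|` l).
Proof.
move=> connT oA connl [x lx] disj cAl.
move=> S Sn0 [U oU BU] [F cF BF].
have clopen D : open D -> closed D -> D !=set0 -> D x.
  by move=> oD cD [z Dz]; rewrite (connected_clopen connT oD cD Dz).
have [lB|lB] := pselect (exists2 y, l y & S y).
  have lsubB : l `<=` S.
    suff <- : l `&` S = l by move=> z [].
    apply: connl.
    - by case: lB => y ly By; exists y.
    - by exists U => //; rewrite BU setIA (setIidl (@subsetUr _ A l)).
    - by exists F => //; rewrite BF setIA (setIidl (@subsetUr _ A l)).
  apply/seteqP; split=> [y|y ABy]; first by rewrite BU => -[].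
  apply: contrapT => nBy.
  have [] : ((A `|` l) `&` ~` U) x.
    apply: clopen.
    - have -> : (A `|` l) `&` ~` U = A `&` ~` F.
        apply/seteqP; split=> z.
          move=> [ABz nU]; have nB : ~ S z by rewrite BU => -[].
          split; last by move=> Fz; apply: nB; rewrite BF.
          by case: ABz => // /lsubB.
        move=> [Az nF]; split; first by left.
        by move=> Oz; apply: nF; have : S z by [rewrite BU; split=> //; left];
          rewrite BF => -[].
      by apply: openI => //; rewrite openC.
    - by apply: closedI => //; rewrite closedC.
    - by exists y; split=> // Oy; apply: nBy; rewrite BU.
  by move=> _; apply; have := lsubB x lx; rewrite BU => -[].
exfalso; apply: (lB); exists x => //; apply: clopen => //.
  have -> : S = A `&` U.
    apply/seteqP; split=> z; rewrite ?BU => -[ABz Oz]; split=> //; last by left.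
    by case: ABz => // lz; exfalso; apply: lB; exists z => //; rewrite BU;
      split=> //; right.
  exact: openI.
by rewrite BF; exact: closedI.
Qed.

Section side_lemmas.
Variables (R : realType) (P : topologicalType) (pp pm : P -> P -> Prop).
Hypothesis bif : bifoliation R pp pm.
Let linesP := bif_p bif.
Let linesM := bif_m bif.
Local Notation up := (above pp pm).
Local Notation dn := (below pp pm).

Lemma above_eq x y : lf pp x y -> up x = up y.
Proof. by move=> xy; rewrite /above (lf_eq linesP xy). Qed.

Lemma below_eq x y : lf pp x y -> dn x = dn y.
Proof. by move=> xy; rewrite /below (above_eq xy) (lf_eq linesP xy). Qed.

Lemma open_above x : open (up x).
Proof. exact: side_open (above_side bif x). Qed.

Lemma open_below x : open (dn x).
Proof. exact: side_compl_open (above_side bif x). Qed.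

Lemma above_next x y : pm x y -> up x y.
Proof. exact: side_next (above_side bif x) _ _ (lf_refl _ _). Qed.

Lemma below_prev x y : pm y x -> dn x y.
Proof. exact: side_prev (above_side bif x) _ _ (lf_refl _ _). Qed.

Lemma above_nlf x y : up x y -> ~ lf pp x y.
Proof. exact: side_disj (above_side bif x) _. Qed.

Lemma below_nlf x y : dn x y -> ~ lf pp x y.
Proof. by move=> h xy; apply: h; right. Qed.

Lemma above_nbelow x y : up x y -> ~ dn x y.
Proof. by move=> h; apply; left. Qed.

Lemma sideP x y : [\/ up x y, lf pp x y | dn x y].
Proof.
have [h|h] := pselect (up x y); first exact: Or31.
have [h'|h'] := pselect (lf pp x y); first exact: Or32.
by apply: Or33 => -[].
Qed.

Definition upper x : set P := up x `|` lf pp x.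
Definition lower x : set P := dn x `|` lf pp x.

Lemma upperC x : ~` upper x = dn x. Proof. by []. Qed.

Lemma lowerC x : ~` lower x = up x.
Proof.
apply/seteqP; split=> y; last by move=> h [/(above_nbelow h)|/(above_nlf h)].
by have [//|h|h] := sideP x y => n; exfalso; apply: n; [right|left].
Qed.

Lemma closed_upper x : closed (upper x).
Proof. by rewrite -openC upperC; exact: open_below. Qed.

Lemma closed_lower x : closed (lower x).
Proof. by rewrite -openC lowerC; exact: open_above. Qed.

Lemma connected_upper x : connected (upper x).
Proof.
apply: connected_openU;
  [exact: plane_connected (bif_plane bif)|exact: open_above| | | |exact:
    closed_upper].
- exact: (lf_connected linesP).
- by exists x; exact: lf_refl.
- exact: above_nlf.
Qed.

Lemma connected_lower x : connected (lower x).
Proof.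
apply: connected_openU;
  [exact: plane_connected (bif_plane bif)|exact: open_below| | | |exact:
    closed_lower].
- exact: (lf_connected linesP).
- by exists x; exact: lf_refl.
- exact: below_nlf.
Qed.

Lemma connected_above x (C : set P) y : connected C ->
  (forall z, C z -> ~ lf pp x z) -> C y -> up x y -> C `<=` up x.
Proof.
move=> conn nl Cy uy; suff <- : C `&` up x = C by move=> z [].
apply: conn.
- by exists y.
- by exists (up x) => //; exact: open_above.
- exists (upper x); first exact: closed_upper.
  apply/seteqP; split=> z [Cz h]; split=> //; first by left.
  by case: h => // /(nl _ Cz).
Qed.

Lemma connected_below x (C : set P) y : connected C ->
  (forall z, C z -> ~ lf pp x z) -> C y -> dn x y -> C `<=` dn x.
Proof.
move=> conn nl Cy uy; suff <- : C `&` dn x = C by move=> z [].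
apply: conn.
- by exists y.
- by exists (dn x) => //; exact: open_below.
- exists (lower x); first exact: closed_lower.
  apply/seteqP; split=> z [Cz h]; split=> //; first by left.
  by case: h => // /(nl _ Cz).
Qed.

(** After crossing a [pp]-leaf, a [pm]-leaf stays on its upper side; before, on its lower side. *)
Lemma cross_once x y : lf pp x y -> lf pm x y -> y = x.
Proof.
move=> lxy [//|/above_next/above_nlf|/below_prev/below_nlf]; by move/(_ lxy).
Qed.

Lemma lf_nlf x y : ~ lf pp x y -> forall z, lf pp y z -> ~ lf pp x z.
Proof. by move=> n z yz xz; apply: n;
  exact: (lf_trans linesP xz (lf_sym yz)). Qed.

Lemma above_lf x y : up x y -> lf pp y `<=` up x.
Proof.
move=> h; apply: (connected_above _ _ (lf_refl _ _) h);
  first exact: (lf_connected linesP).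
exact/lf_nlf/above_nlf.
Qed.

Lemma below_lf x y : dn x y -> lf pp y `<=` dn x.
Proof.
move=> h; apply: (connected_below _ _ (lf_refl _ _) h);
  first exact: (lf_connected linesP).
exact/lf_nlf/below_nlf.
Qed.

Lemma upper_lf x y : upper x y -> lf pp y `<=` upper x.
Proof.
by case=> [/above_lf h z /h|h z yz]; [left|right;
  exact: (lf_trans linesP h yz)].
Qed.

Lemma above_crossing x u z : lf pp x u -> lf pm u z -> up x z <-> pm u z.
Proof.
move=> xu uz; rewrite (above_eq xu); split; last exact: above_next.
by case: uz => [->|//|/below_prev/above_nbelow n] /[dup] // /above_nlf;
  have := lf_refl pp u.
Qed.

Lemma below_crossing x u z : lf pp x u -> lf pm u z -> dn x z <-> pm z u.
Proof.
move=> xu uz; rewrite (below_eq xu); split; last exact: below_prev.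
by case: uz => [->|/above_next/above_nbelow n|//] /[dup] // /below_nlf;
  have := lf_refl pp u.
Qed.

(** This and the next three lemmas cover the four relative positions of two disjoint leaves. In
    each, the closed side of [y] that avoids [x] is connected and does not meet the leaf of [x]. *)
Lemma upper_above x y : up x y -> dn y x -> upper y `<=` up x.
Proof.
move=> xy yx; apply: (connected_above _ _ _ xy);
  [exact: connected_upper| |by right; exact: lf_refl].
by move=> z hz xz; have := below_lf yx xz; apply.
Qed.

Lemma lower_above x y : up x y -> up y x -> lower y `<=` up x.
Proof.
move=> xy yx; apply: (connected_above _ _ _ xy);
  [exact: connected_lower| |by right; exact: lf_refl].
by move=> z hz xz; have := above_lf yx xz; rewrite -lowerC.
Qed.

Lemma upper_below x y : dn x y -> dn y x -> upper y `<=` dn x.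
Proof.
move=> xy yx; apply: (connected_below _ _ _ xy);
  [exact: connected_upper| |by right; exact: lf_refl].
by move=> z hz xz; have := below_lf yx xz; apply.
Qed.

Lemma lower_below x y : dn x y -> up y x -> lower y `<=` dn x.
Proof.
move=> xy yx; apply: (connected_below _ _ _ xy);
  [exact: connected_lower| |by right; exact: lf_refl].
by move=> z hz xz; have := above_lf yx xz; rewrite -lowerC.
Qed.

Lemma upper_next x y : pm x y -> upper y `<=` up x.
Proof. by move=> xy; apply: upper_above;
  [exact: above_next|exact: below_prev]. Qed.

(** The part of the upper side that lies outside [A] is open; it is closed since, near the leaf,
    points above it are in [A] and points below it are not in [above x]. As it misses [x], it is
    empty. Automorphisms preserve sides by this uniqueness. *)
Lemma upper_side_uniq x A : upper_side pm (lf pp x) A -> up x `<=` A.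
Proof.
move=> [oA oA' dA nA pA].
have D0 : up x `&` ~` (A `|` lf pp x) = set0.
  apply/eqP; apply: contrapT => /negP/set0P [y Dy].
  have oD : open (up x `&` ~` (A `|` lf pp x)) by apply: openI => //;
    exact: open_above.
  have cD : closed (up x `&` ~` (A `|` lf pp x)).
    rewrite -openC openE => z; rewrite setCI setCK /interior => h.
    have [lz|lz] := pselect (lf pp x z).
      have [psi [[s t] [ch pz]]] := bif_chart bif z.
      have := chart_nbhs_range (s, t) ch; rewrite pz.
      apply: filterS => _ [[s' t'] _ <-].
      have l' : lf pp x (psi (s', t)).
        by apply: (lf_trans linesP lz); rewrite -pz; exact: chart_lf_p ch.
      have [tt|tt|tt] := ltgtP t t'; last by rewrite -tt in l' *; right; right.
        by right; left; apply: nA l' _; rewrite (chart_m ch).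
      left; rewrite (above_eq l') => /above_nbelow; apply; apply: below_prev.
      by rewrite (chart_m ch).
    case: h => [h|[Az|//]].
      have : nbhs z (dn x).
        by apply: open_nbhs_nbhs; split; [exact: open_below|move=> []].
      by apply: filterS => w hw; left => /above_nbelow.
    have : nbhs z A by apply: open_nbhs_nbhs.
    by apply: filterS => w Aw; right; left.
  have : (up x `&` ~` (A `|` lf pp x)) x.
    by rewrite (connected_clopen (plane_connected (bif_plane bif)) oD cD Dy).
  by move=> [/above_nlf]; have := lf_refl pp x.
move=> y uy; apply: contrapT => nAy.
suff : (up x `&` ~` (A `|` lf pp x)) y by rewrite D0.
by split=> // -[//|]; exact: above_nlf.
Qed.

End side_lemmas.

(** * Heights *)

Section quadrants.
Variables (P : topologicalType) (pp pm : P -> P -> Prop).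

(* [quadrant q a]: the positive end of the leaf of [a] lies in the closed
   quadrant of the plane to the right of and above [q]. *)
Definition meets_right (q a : P) : Prop := exists2 u,
  lf pp a u & upper pm pp q u.

Definition quadrant (q a : P) : Prop := meets_right q a /\ upper pp pm q a.

Definition quad (q a : P) : int := Posz (nat_of_bool `[< quadrant q a >]).

(** Correction term of the heights. The quadrant is closed, so [quad x a] is still 1 on the leaf of
    [a]; subtracting this term makes the height pass from -1 to 0 on reaching that leaf from below,
    as an integral part does. *)
Definition same_leaf (x a : P) : int := Posz (nat_of_bool `[< lf pp x a >]).

(* [H x] stands for the integral part of the difference between the lifts of
   the positive ends of the leaves of [x] and [a]. *)
Record is_height (a : P) (H : P -> int) : Prop := {
  height_base : H a = 0;
  height_p : forall x y, pp x y -> H x = H y;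
  height_m : forall x y, pm x y ->
    H x + quad x a - same_leaf x a = H y + quad y a - same_leaf y a }.

Definition height (a : P) : P -> int := xget (fun=> 0) (is_height a).

End quadrants.

Section quadrant_theory.
Variables (R : realType) (P : topologicalType) (pp pm : P -> P -> Prop).
Hypothesis bif : bifoliation R pp pm.
Let linesP := bif_p bif.
Let linesM := bif_m bif.
Let fib := bifoliation_swap bif.
Local Notation up := (above pp pm).
Local Notation dn := (below pp pm).
Local Notation ri := (above pm pp).
Local Notation le := (below pm pp).
Local Notation upc := (upper pp pm).
Local Notation dnc := (lower pp pm).
Local Notation ric := (upper pm pp).
Local Notation lec := (lower pm pp).
Local Notation V := (quad pp pm).

Lemma upper_eq x y : lf pp x y -> upc x = upc y.
Proof. by move=> h; rewrite /upper (above_eq bif h) (lf_eq linesP h). Qed.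

Lemma lower_eq x y : lf pp x y -> dnc x = dnc y.
Proof. by move=> h; rewrite /lower (below_eq bif h) (lf_eq linesP h). Qed.

Lemma meets_right_lf q a a' : lf pp a a' -> meets_right pp pm q a ->
  meets_right pp pm q a'.
Proof. by move=> aa [u au h]; exists u => //;
  exact: (lf_trans linesP (lf_sym aa)). Qed.

(** A [pp]-leaf crosses the [pm]-leaf of [q] at most once, from left to right. Thus a leaf that
    meets the closed right side either crosses or stays on the right, and in both cases its positive
    end is there. *)
Lemma meets_rightE q a : meets_right pp pm q a ->
  (exists2 u, lf pp a u & lf pm q u) \/ lf pp a `<=` ri q.
Proof.
move=> [u au qu]; have [h|h] := pselect (exists2 u, lf pp a u & lf pm q u);
  first by left.
right; apply: (connected_above fib _ _ au).
- exact: (lf_connected linesP).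
- by move=> z az qz; apply: h; exists z.
- by case: qu => // qu; exfalso; apply: h; exists u.
Qed.

Lemma upper_lfP q a a' : lf pp a a' -> upc q a -> upc q a'.
Proof. by move=> aa /(upper_lf bif); apply. Qed.

Lemma quad_lf q a a' : lf pp a a' -> V q a = V q a'.
Proof.
move=> aa; rewrite /quad; suff -> : quadrant pp pm q a = quadrant pp pm q a' by
  [].
have aa' := lf_sym aa.
by apply/propext; split=> -[/meets_right_lf h1 /upper_lfP h2]; split;
  [exact: h1|exact: h2|exact: h1|exact: h2].
Qed.

Lemma upper_mono q q' : pm q q' -> upc q' `<=` upc q.
Proof. by move=> qq y /(upper_next bif qq); left. Qed.

Lemma meets_right_mono q q' a : pp q q' -> meets_right pp pm q' a ->
  meets_right pp pm q a.
Proof. by move=> qq [u au h]; exists u => //; left;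
  exact: (upper_next fib qq). Qed.

Lemma chart_between (psi : R * R -> P) s1 s2 t p : box_chart pp pm psi ->
  lf pp (psi (s1, t)) p -> ric (psi (s1, t)) p -> lec (psi (s2, t)) p ->
  range psi p.
Proof.
move=> h l1 r1 l2; have h' := box_chart_swap h.
have lp2 : lf pp (psi (s2, t)) p.
  by apply: (lf_trans linesP) l1; exact: chart_lf_p h.
case: r1 => [|h1]; last first.
  by rewrite (cross_once bif l1 h1); exists (s1, t).
case: l2 => [|h2]; last first.
  by rewrite (cross_once bif lp2 h2); exists (s2, t).
rewrite (below_crossing fib (lf_refl _ _) lp2) (above_crossing fib (lf_refl _
  _) l1) => h2 h1.
have [s <-] := chart_between_m fib h' (s := t) h1 h2.
by exists (s, t).
Qed.

Section one_chart.
Variable psi : R * R -> P.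
Hypothesis ch : box_chart pp pm psi.

Lemma chart_upper s t s' t' : upc (psi (s, t)) (psi (s', t')) -> t <= t'.
Proof.
have l : lf pp (psi (s, t)) (psi (s', t)) := chart_lf_p s s' t ch.
case=> [|h]; first by
  rewrite (above_crossing bif l (chart_lf_m _ _ _ ch)) (chart_m ch) => /ltW.
have := cross_once bif (lf_trans linesP (lf_sym l) h) (chart_lf_m _ _ _ ch).
by move=> /(chart_inj ch) [->].
Qed.

Lemma chart_lower s t s' t' : dnc (psi (s, t)) (psi (s', t')) -> t' <= t.
Proof.
have l : lf pp (psi (s, t)) (psi (s', t)) := chart_lf_p s s' t ch.
case=> [|h]; first by
  rewrite (below_crossing bif l (chart_lf_m _ _ _ ch)) (chart_m ch) => /ltW.
have := cross_once bif (lf_trans linesP (lf_sym l) h) (chart_lf_m _ _ _ ch).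
by move=> /(chart_inj ch) [->].
Qed.

End one_chart.

End quadrant_theory.

Section rect.
Variables (R : realType) (P : topologicalType) (pp pm : P -> P -> Prop).
Hypothesis bif : bifoliation R pp pm.
Let linesP := bif_p bif.
Let linesM := bif_m bif.
Let fib := bifoliation_swap bif.
Local Notation up := (above pp pm).
Local Notation dn := (below pp pm).
Local Notation ri := (above pm pp).
Local Notation le := (below pm pp).
Local Notation upc := (upper pp pm).
Local Notation dnc := (lower pp pm).
Local Notation ric := (upper pm pp).
Local Notation lec := (lower pm pp).
Local Notation V := (quad pp pm).

(* The region between two horizontal and two vertical leaves of a chart is
   the compact rectangle of the chart: the rest of it is open and closed. *)
Lemma chart_rect (psi : R * R -> P) s1 s2 t1 t2 p : box_chart pp pm psi ->
  upc (psi (s1, t1)) p -> dnc (psi (s2, t2)) p ->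
  ric (psi (s1, t1)) p -> lec (psi (s2, t2)) p -> range psi p.
Proof.
move=> ch; have ch' := box_chart_swap ch.
pose Cl := upc (psi (s1, t1)) `&` dnc (psi (s2, t2)) `&`
  (ric (psi (s1, t1)) `&` lec (psi (s2, t2))).
pose K := psi @` rect s1 s2 t1 t2.
have cK : closed K.
  apply: compact_closed; first exact: plane_hausdorff (bif_plane bif).
  apply: continuous_compact; last exact: compact_rect.
  by apply: continuous_subspaceT; exact: chart_continuous ch.
have ClK w : Cl w -> range psi w -> K w.
  move=> [[h1 h2] [h3 h4]] [[s t] _ e]; exists (s, t) => //;
    rewrite -e in h1 h2 h3 h4.
  rewrite /rect /= (chart_upper bif ch h1) (chart_lower bif ch h2).
  by rewrite (chart_upper fib ch' (s := t1) (s' := t) h3)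
    (chart_lower fib ch' (s := t2) (s' := t) h4).
have cCl : closed Cl.
  apply: closedI; apply: closedI;
    [exact: (closed_upper bif)|exact: (closed_lower bif)| |].
    exact: (closed_upper fib).
  exact: (closed_lower fib).
move=> h1 h2 h3 h4; apply: contrapT => np.
pose D := Cl `&` ~` range psi.
have cD : closed D.
  apply: closedI => //; rewrite closedC; apply: chart_open ch _ _; exact: openT.
have oD : open D.
  rewrite openE => w [[[u1 d2] [r1 l2]] nw]; rewrite /interior.
  have nb (A : set P) : open A -> A w -> nbhs w A by move=> *;
    apply: open_nbhs_nbhs.
  have lE1 s t s' : lf pm (psi (s, t)) (psi (s, s')) by exact: chart_lf_m ch.
  have lE2 s t s' : lf pp (psi (s, t)) (psi (s', t)) by exact: chart_lf_p ch.
  have n1 : ~ lf pp (psi (s1, t1)) w.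
    move=> lw; apply: nw; apply: (chart_between (s2 := s2) bif ch lw r1).
    by rewrite (lower_eq fib (lE1 s2 t1 t2)).
  have n2 : ~ lf pp (psi (s2, t2)) w.
    move=> lw; apply: nw; have lw' := lf_trans linesP (lE2 s1 t2 s2) lw.
    by apply: (chart_between (s1 := s1) bif ch lw' _ l2);
      rewrite -(upper_eq fib (lE1 s1 t1 t2)).
  have n3 : ~ lf pm (psi (s1, t1)) w.
    move=> lw; apply: nw.
    have [|[a b] _ e] := chart_between fib ch' (s1 := t1) (s2 := t2) (t :=
      s1) (p := w) lw u1.
      by rewrite /= (lower_eq bif (lE2 s1 t2 s2)).
    by exists (b, a).
  have n4 : ~ lf pm (psi (s2, t2)) w.
    move=> lw; apply: nw.
    have [||[a b] _ e] := chart_between fib ch' (s1 := t1) (s2 := t2) (t :=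
      s2) (p := w) _ _ d2.
    - by apply: (lf_trans linesM) lw; exact: lE1.
    - by rewrite /= -(upper_eq bif (lE2 s1 t1 s2)).
    by exists (b, a).
  have : nbhs w (up (psi (s1, t1)) `&` dn (psi (s2, t2)) `&`
    (ri (psi (s1, t1)) `&` le (psi (s2, t2))) `&` ~` K).
    apply: nb.
      apply: openI; last by rewrite openC.
      apply: openI; apply: openI;
        [exact: (open_above bif)|exact: (open_below bif)|exact: (open_above
          fib)|exact: (open_below fib)].
    split; last by move=> [x _ e]; apply: nw; exists x.
    by split; split; [case: u1|case: d2|case: r1|case: l2].
  apply: filterS => z [[[a1 a2] [a3 a4]] nK].
  have Clz : Cl z by split; split; left.
  by split=> // /(ClK _ Clz).
have := connected_clopen (plane_connected (bif_plane bif)) oD cD (conj (conj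
  (conj h1 h2) (conj h3 h4)) np).
move=> DT; have [_ []] : D (psi (s1, t1)) by rewrite DT.
by exists (s1, t1).
Qed.

(** In a chart [quad] is a product of two nonincreasing step functions, [e] of the abscissa and [u]
    of the ordinate. The mixed difference could fail to vanish only if both dropped across the same
    rectangle; the leaf of [a] would then have a point in that rectangle, hence cross its right
    edge, and [e] would not drop. *)
Lemma quad_rect (psi : R * R -> P) a s s' t t' : box_chart pp pm psi ->
  V (psi (s, t)) a - V (psi (s, t')) a = V (psi (s', t)) a - V (psi (s', t')) a.
Proof.
move=> ch; have ch' := box_chart_swap ch.
have lE1 x y z : lf pm (psi (x, y)) (psi (x, z)) by exact: chart_lf_m ch.
have lE2 x y z : lf pp (psi (x, y)) (psi (z, y)) by exact: chart_lf_p ch.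
pose e s := `[< meets_right pp pm (psi (s, 0)) a >].
pose u t := `[< upc (psi (0, t)) a >].
have VE x y : V (psi (x, y)) a = Posz (nat_of_bool (e x && u y)).
  rewrite /quad /e /u -asbool_and; congr (Posz (nat_of_bool _)).
  by rewrite /quadrant /meets_right (upper_eq fib (lE1 x y 0)) (upper_eq bif
    (lE2 x y 0)).
have e_mono x y : x < y -> e y -> e x.
  move=> xy /asboolP h; apply/asboolP.
  by apply: (meets_right_mono bif) h; rewrite (chart_p ch).
have u_mono x y : x < y -> u y -> u x.
  move=> xy /asboolP h; apply/asboolP.
  by apply: (upper_mono bif) h; rewrite (chart_m ch).
have key x y z w : x < y -> z < w -> e x -> ~~ e y -> u z -> ~~ u w -> False.
  move=> xy zw /asboolP [b ab rb] /asboolP ne /asboolP uz /asboolP nu.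
  have [[s0 t0] _ eb] : range psi b.
  - apply: (chart_rect (s1 := x) (s2 := y) (t1 := z) (t2 := w) ch).
    + by apply: (upper_lfP bif ab); rewrite (upper_eq bif (lE2 x z 0)).
    + left; move: nu; rewrite (upper_eq bif (lE2 0 w y)) => nu hb.
      by apply: nu; apply: (upper_lfP bif (lf_sym ab)).
    + by rewrite (upper_eq fib (lE1 x z 0)).
    + left => hb; apply: ne; exists b => //.
      by rewrite (upper_eq fib (lE1 y 0 w)).
  apply: ne; exists (psi (y, t0)).
    by apply: (lf_trans linesP ab); rewrite -eb.
  by right.
have main x y z w : x < y -> z < w ->
  V (psi (x, z)) a - V (psi (x, w)) a = V (psi (y, z)) a - V (psi (y, w)) a.
  move=> xy zw; rewrite !VE.
  have := e_mono _ _ xy; have := u_mono _ _ zw; have := key _ _ _ _ xy zw.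
  by case: (e x); case: (e y); case: (u z); case: (u w) => //= h1 h2 h3;
    first [by have := h1 isT isT isT isT|by have := h2 isT|by have := h3 isT].
have [ss|ss|->] := ltgtP s s' => //; have [tt|tt|->] := ltgtP t t';
  rewrite ?subrr //.
- exact: main.
- by have := main _ _ _ _ ss tt;
  move: (V _ a) (V _ a) (V _ a) (V _ a) => ? ? ? ?; lia.
- by have := main _ _ _ _ ss tt;
  move: (V _ a) (V _ a) (V _ a) (V _ a) => ? ? ? ?; lia.
- by have := main _ _ _ _ ss tt;
  move: (V _ a) (V _ a) (V _ a) (V _ a) => ? ? ? ?; lia.
Qed.

Lemma lf_constant (prec : P -> P -> Prop) (T : Type) (F : P -> T) :
  oriented_lines R prec ->
  (forall z, \forall w \near z, lf prec z w -> F w = F z) ->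
  forall x y, prec x y -> F x = F y.
Proof.
move=> lines loc x y xy.
have cst := connected_eq_const (F := F) (@lf_connected R P prec lines x).
apply/esym/(cst _ x y); [|exact: lf_refl|exact: Or32].
move=> z xz; have := loc z; apply: filterS => w h xw; apply: h.
exact: (lf_trans lines (lf_sym xz)).
Qed.

(** The increment is the decrease of [quad] along the vertical through [z], horizontal moves being
    free. By [quad_rect] any vertical of the chart gives the same increment, and the common corner
    of [chart_corner] compares two charts; this is the cocycle condition. *)
Lemma height_exists a : exists H, is_height pp pm a H.
Proof.
have [psi hpsi] := choice (bif_chart bif).
have [p hp] := choice hpsi.
have ch z : box_chart pp pm (psi z) by case: (hp z).
have pz z : psi z (p z) = z by case: (hp z).
pose inv z w := xget (p z) [set x | psi z x = w].
have invE z x : inv z (psi z x) = x.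
  apply: (chart_inj (ch z)).
  have : exists y, [set y | psi z y = psi z x] y by exists x.
  exact: xgetPex.
pose k z w := V z a - V (psi z ((p z).1, (inv z w).2)) a.
have [||h hP] := monodromy (bif_plane bif) (U := fun z => range (psi z)) (k :=
  k).
- by move=> z; have := chart_nbhs_range (p z) (ch z); rewrite pz.
- move=> z y [[s t] _ e].
  have := chart_corner bif (ch y) (ch z) (etrans (pz y) (esym e)).
  rewrite pz; apply: filterS => w [s1 [t1 [s2 [t2 [e1 e2 e3]]]]].
  have -> : k y w = V z a - V z a + V y a - V (psi y ((p y).1, t1)) a.
    by rewrite /k {1}e1 invE subrr add0r.
  rewrite /k {1}e2 -{1}e !invE /=.
  have := quad_rect a s2 (p z).1 t t2 (ch z); rewrite -e2 /= in e3 *.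
  have := quad_rect a s1 (p y).1 (p y).2 t1 (ch y).
  rewrite -surjective_pairing pz e3 -e1; lia.
(* The primitive satisfies the rules without the correction on the leaf of [a], which is added here
   together with the normalization at [a]. *)
exists (fun x => h x + same_leaf pp x a - (h a + same_leaf pp a a)); split;
  first lia.
- move=> x y xy.
  have -> : same_leaf pp x a = same_leaf pp y a.
    rewrite /same_leaf; suff -> : lf pp x a = lf pp y a by [].
    by rewrite (lf_eq linesP (Or32 _ _ xy)).
  suff -> : h x = h y by [].
  apply: lf_constant xy => // z.
  have [W Wn WP] := chart_nbhs_m fib (swap (p z)) (box_chart_swap (ch z)).
  have e : (psi z \o @swap R R) (swap (p z)) = z.
    by rewrite /= -[RHS]pz; case: (p z).
  rewrite e in Wn WP; have := hP z; have := Wn; apply: filterS2 => w Ww -> zw.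
  have [t <-] := WP w Ww zw;
    rewrite /k /swap /= invE /= -surjective_pairing pz; lia.
- move=> x y xy; suff : h x + V x a = h y + V y a by lia.
  apply: (lf_constant (F := fun x => h x + V x a)) xy => // z.
  have [W Wn WP] := chart_nbhs_m bif (p z) (ch z).
  rewrite pz in Wn WP; have := hP z; have := Wn; apply: filterS2 => w Ww -> zw.
  have [t e] := WP w Ww zw; rewrite /k -{1}e invE /= e; lia.
Qed.

Lemma heightP a : is_height pp pm a (height pp pm a).
Proof. by rewrite /height; case: xgetP => // n;
  have [H /n] := height_exists a. Qed.

Lemma same_lf x y a : lf pp x y -> same_leaf pp x a = same_leaf pp y a.
Proof.
by move=> xy; rewrite /same_leaf (lf_eq linesP xy).
Qed.

Lemma same_sym x y : same_leaf pp x y = same_leaf pp y x.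
Proof.
rewrite /same_leaf; congr (Posz (nat_of_bool _)); apply: asbool_equiv_eq.
by split=> /lf_sym.
Qed.

Lemma height_unique a H H' : is_height pp pm a H -> is_height pp pm a H' -> H =
  H'.
Proof.
move=> [H0 Hp Hm] [H0' Hp' Hm']; apply/funext => x.
suff : H x - H' x = H a - H' a by lia.
apply: (leaf_constant bif (F := fun x => H x - H' x)) => u v uv.
  by rewrite (Hp _ _ uv) (Hp' _ _ uv).
by have := Hm _ _ uv; have := Hm' _ _ uv; lia.
Qed.

End rect.

(** * The cocycle of heights *)

Section cocycle.
Variables (R : realType) (P : topologicalType) (pp pm : P -> P -> Prop).
Hypothesis bif : bifoliation R pp pm.
Let linesP := bif_p bif.
Let linesM := bif_m bif.
Let fib := bifoliation_swap bif.
Local Notation up := (above pp pm).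
Local Notation dn := (below pp pm).
Local Notation ri := (above pm pp).
Local Notation le := (below pm pp).
Local Notation upc := (upper pp pm).
Local Notation dnc := (lower pp pm).
Local Notation ric := (upper pm pp).
Local Notation lec := (lower pm pp).
Local Notation V := (quad pp pm).
Local Notation mr := (meets_right pp pm).
Local Notation H := (height pp pm).
Local Notation same := (same_leaf pp).

Lemma quad_true q a : mr q a -> upc q a -> V q a = 1.
Proof. by move=> h1 h2; rewrite /quad asboolT. Qed.

Lemma quad_false q a : ~ (mr q a /\ upc q a) -> V q a = 0.
Proof. by move=> h; rewrite /quad asboolF. Qed.

Lemma quadP q a : (V q a = 1 /\ (mr q a /\ upc q a)) \/
  (V q a = 0 /\ ~ (mr q a /\ upc q a)).
Proof.
have [h|h] := pselect (mr q a /\ upc q a); [left|right]; split=> //.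
  by case: h; exact: quad_true.
exact: quad_false.
Qed.

Lemma quad_equiv q a q' a' : (mr q a /\ upc q a <-> mr q' a' /\ upc q' a') ->
  V q a = V q' a'.
Proof. by move=> h; rewrite /quad; congr (Posz (nat_of_bool _));
  exact: asbool_equiv_eq. Qed.

Lemma same_true x y : lf pp x y -> same x y = 1.
Proof. by move=> h; rewrite /same_leaf asboolT. Qed.

Lemma same_false x y : ~ lf pp x y -> same x y = 0.
Proof. by move=> h; rewrite /same_leaf asboolF. Qed.

Lemma mr_m q q' a : lf pm q q' -> mr q a -> mr q' a.
Proof. by move=> qq [u au h]; exists u => //; rewrite -(upper_eq fib qq). Qed.

Lemma mr_self q b : lf pm q b -> mr q b.
Proof. by move=> h; exists b; [exact: lf_refl|right]. Qed.

Lemma mr_right q b : ri q b -> mr q b.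
Proof. by move=> h; exists b; [exact: lf_refl|left]. Qed.

Lemma mr_left q b : le q b -> mr q b -> exists2 u, lf pp b u & lf pm q u.
Proof.
move=> lqb /(meets_rightE bif) [//|h].
by exfalso; have := above_nbelow (h b (lf_refl _ _)) lqb.
Qed.

Lemma quad_mono q q' a : pm q q' -> V q' a <= V q a.
Proof.
move=> qq; case: (quadP q' a) => -[-> h']; case: (quadP q a) => -[-> h] //.
exfalso; apply: h; split; first by apply: mr_m h'.1; exact: Or33.
exact: (upper_mono bif qq) h'.2.
Qed.

Lemma upperN x y : ~ upc x y -> dn x y. Proof. by []. Qed.

Lemma dn_upperN x y : dn x y -> ~ upc x y. Proof. by []. Qed.

(** The obstruction to controlling the base: [H b x - V b x] depends on [b] along a [pm]-leaf by an
    amount constant in [x] as soon as the mixed differences of [symm] vanish. *)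
Definition symm q b : int := V q b + V b q - same q b.

Lemma symmC q b : symm q b = symm b q.
Proof. by rewrite /symm (same_sym _ q b) (addrC (V q b)). Qed.

Lemma symm_same q b : lf pm q b -> symm q b = 1.
Proof.
wlog: q b / b = q \/ pm q b.
  move=> h [->|qb|qb]; first by apply: h; [left|exact: lf_refl].
    by apply: h; [right|exact: Or32].
  by rewrite symmC; apply: h; [right|exact: Or32].
case=> [->|qb] lqb; rewrite /symm.
  rewrite !quad_true ?same_true //; [exact: lf_refl|exact: mr_self|].
  by right; exact: lf_refl.
rewrite quad_true ?quad_false ?same_false //.
- by apply: (above_nlf bif); exact: (above_next bif).
- by move=> [_]; apply: dn_upperN; exact: (below_prev bif).
- exact: mr_self.
- by left; exact: (above_next bif).
Qed.

(** Along the leaf of [b], the crossing [u] would come both after and before [b]. *)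
Lemma right_right_disj q b u :
  ri q b -> ri b q -> lf pp b u -> lf pm q u -> False.
Proof.
move=> qb bq bu qu.
have : pp b u.
  by rewrite -(above_crossing fib (lf_refl pm b) bu); exact: (above_lf fib bq).
have : pp u b.
  by rewrite -(above_crossing fib (lf_refl pm u) (lf_sym bu)) -(above_eq fib
    qu).
exact: (prec_asym linesP).
Qed.

Lemma left_left_disj q b u :
  le q b -> le b q -> lf pp b u -> lf pm q u -> False.
Proof.
move=> qb bq bu qu.
have : pp u b.
  by rewrite -(below_crossing fib (lf_refl pm b) bu); exact: (below_lf fib bq).
have : pp b u.
  by rewrite -(below_crossing fib (lf_refl pm u) (lf_sym bu)) -(below_eq fib
    qu).
exact: (prec_asym linesP).
Qed.

Lemma symm_left_left q b : le q b -> le b q -> symm q b = 0.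
Proof.
move=> qb bq; rewrite /symm !quad_false ?same_false //.
- by move=> qb'; apply: (left_left_disj qb bq (lf_sym qb')); exact: lf_refl.
- move=> [/(mr_left bq)[u qu bu] _]; exact: (left_left_disj bq qb qu bu).
- move=> [/(mr_left qb)[u qu bu] _]; exact: (left_left_disj qb bq qu bu).
Qed.

Lemma m_above x y z : lf pm y z -> (forall u, lf pp x u -> ~ lf pm y u) ->
  up x y -> up x z.
Proof.
move=> yz n xy; have nl w : lf pm y w -> ~ lf pp x w by move=> yw xw;
  exact: (n w).
exact: (connected_above bif (@lf_connected _ _ _ linesM y) nl (lf_refl pm y)
  xy).
Qed.

Lemma m_below x y z : lf pm y z -> (forall u, lf pp x u -> ~ lf pm y u) ->
  dn x y -> dn x z.
Proof.
move=> yz n xy; have nl w : lf pm y w -> ~ lf pp x w by move=> yw xw;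
  exact: (n w).
exact: (connected_below bif (@lf_connected _ _ _ linesM y) nl (lf_refl pm y)
  xy).
Qed.

Lemma m_upper x y z : lf pm y z -> (forall u, lf pp x u -> ~ lf pm y u) ->
  upc x y -> upc x z.
Proof.
move=> yz n [/(m_above yz n)|h]; first by left.
by exfalso; apply: (n y h); exact: lf_refl.
Qed.

(** If the leaf of [b] crosses the [pm]-leaf of [q], then [b] can be slid to the crossing and both
    values are 1. Otherwise only [quad b q] survives, and the whole [pm]-leaf of [q] is on one side
    of the leaf of [b]. *)
Lemma symm_right_left q q' b : lf pm q q' -> ri b q -> le q b ->
  symm q b = symm q' b.
Proof.
move=> qq bq qb.
have bq' : ri b q' by exact: (above_lf fib bq).
have qb' : le q' b by rewrite -(below_eq fib qq).
have [[u bu qu]|n] := pselect (exists2 u, lf pp b u & lf pm q u).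
  have one x : lf pm q x -> ri b x -> symm x b = 1.
    move=> qx bx; have xu : lf pm x u by exact: (lf_trans linesM (lf_sym qx)).
    rewrite -(symm_same xu) /symm (quad_lf bif x bu).
    rewrite (same_sym pp x b) (same_lf bif x bu) (same_sym pp u x);
      congr (_ + _ - _).
    apply: quad_equiv; rewrite (upper_eq bif bu); split=> -[_ h]; split=> //.
      by apply: mr_self; exact: lf_sym.
    exact: mr_right.
  by rewrite !one //; exact: lf_refl.
have zero x : lf pm q x -> le x b -> symm x b = V b x.
  move=> qx xb; rewrite /symm quad_false ?same_false ?add0r ?subr0 //.
    by move=> xb'; apply: n; exists x => //; exact: lf_sym.
  move=> [/(mr_left xb)[u bu xu] _]; apply: n; exists u => //.
  exact: (lf_trans linesM qx).
rewrite !zero //; last exact: lf_refl.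
have n' u : lf pp b u -> ~ lf pm q u by move=> bu qu; apply: n; exists u.
apply: quad_equiv; split=> -[_ h]; (split; first exact: mr_right).
  exact: m_upper h.
apply: (m_upper (lf_sym qq)) h => u bu qu; apply: (n' u bu).
exact: (lf_trans linesM qq).
Qed.

Lemma quad_right_right q b b' : lf pm b b' -> ri q b -> ri b q ->
  V q b = V q b'.
Proof.
move=> bb qb bq.
have qb' : ri q b'.
  exact: (above_lf fib qb).
have bq' : ri b' q by rewrite -(above_eq fib bb).
have n u : lf pp q u -> ~ lf pm b u by move=> qu bu;
  exact: (right_right_disj bq qb qu bu).
apply: quad_equiv; split=> -[_ h]; (split; first exact: mr_right).
  exact: m_upper h.
apply: (m_upper (lf_sym bb)) h => u bu qu; apply: (n u bu).
exact: (lf_trans linesM bb).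
Qed.

(** The two [pm]-leaves are fixed. If they coincide, or each is to the left of the other, [symm] is
    constant; if only one is to the right of the other, it depends on the point of the left leaf
    alone; if each is to the right of the other, it is a sum of one term in [q] and one in [b]. *)
Lemma symm_mixed q q' b b' : lf pm q q' -> lf pm b b' ->
  symm q b - symm q' b = symm q b' - symm q' b'.
Proof.
move=> qq bb.
have [qb|qb|qb] := sideP pm pp q b; first last.
- have qb' : le q b' by exact: (below_lf fib qb).
  have [bq|bq|bq] := sideP pm pp b q.
  + have bq' : ri b' q by rewrite -(above_eq fib bb).
    by rewrite (symm_right_left qq bq qb) (symm_right_left qq bq' qb') !subrr.
  + by exfalso; have := below_nlf qb; apply; exact: lf_sym.
  + rewrite !symm_left_left //.
    * by rewrite -(below_eq fib qq).
    * by rewrite -(below_eq fib bb); exact: (below_lf fib bq).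
    * by rewrite -(below_eq fib bb).
    * by rewrite -(below_eq fib qq).
    * exact: (below_lf fib bq).
- rewrite !symm_same //.
  + apply: (lf_trans linesM) bb; apply: (lf_trans linesM) qb; exact: lf_sym.
  + exact: (lf_trans linesM) qb bb.
  + exact: (lf_trans linesM) (lf_sym qq) qb.
have qb' : ri q b' by exact: (above_lf fib qb).
have [bq|bq|bq] := sideP pm pp b q.
- have bq' : ri b q' by exact: (above_lf fib bq).
  have q'b : ri q' b by rewrite -(above_eq fib qq).
  have ns x y : ri x y -> ri y x -> same x y = 0.
    move=> xy yx; apply: same_false => s.
    by apply: (right_right_disj xy yx (lf_sym s)); exact: lf_refl.
  have b'q : ri b' q by rewrite -(above_eq fib bb).
  have b'q' : ri b' q' by rewrite -(above_eq fib bb).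
  have q'b' : ri q' b' by rewrite -(above_eq fib qq).
  rewrite /symm !ns // (quad_right_right bb qb bq) (quad_right_right bb q'b
    bq').
  rewrite (quad_right_right qq bq qb) (quad_right_right qq b'q qb'); lia.
- by exfalso; have := above_nlf bif; have := above_nlf fib qb; move=> n _;
  apply: n; exact: lf_sym.
- have bq' : le b q' by exact: (below_lf fib bq).
  have q'b : ri q' b by rewrite -(above_eq fib qq).
  by rewrite (symmC q b) (symmC q' b) (symm_right_left bb qb bq)
    (symm_right_left bb q'b bq') (symmC q b') (symmC q' b').
Qed.

Lemma height_lf a x y : lf pp x y -> H a x = H a y.
Proof.
have [_ h _] := heightP bif a.
by case=> [->//|/h|/h].
Qed.

Lemma height_lfm a x y : lf pm x y ->
  H a x + V x a - same x a = H a y + V y a - same y a.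
Proof.
have [_ _ h] := heightP bif a.
by case=> [->//|/h|/h].
Qed.

Lemma height_base_lf a x : lf pp a x -> H a x = 0.
Proof. by move=> /(height_lf a) <-; exact: height_base (heightP bif a). Qed.

Lemma height_self a : H a a = 0.
Proof. exact: height_base (heightP bif a). Qed.

Lemma height_eq a a' : lf pp a a' -> H a = H a'.
Proof.
move=> aa; apply: (height_unique bif _ (heightP bif a')).
have [_ h1 h2] := heightP bif a; split=> //; first exact: height_base_lf.
move=> x y xy; have := h2 x y xy.
by rewrite !(quad_lf bif _ aa) !(same_sym pp _ a) !(same_lf bif _ aa)
  !(same_sym pp a').
Qed.

Lemma height_line m u : lf pm m u -> H m u = same u m - V u m.
Proof.
move=> mu; have := height_lfm m mu.
have := symm_same (lf_refl pm m); rewrite /symm height_self.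
rewrite (same_true (lf_refl pp m)); lia.
Qed.

(** The difference of the two sides is constant in [x]: on [pp]-leaves every term is, and on
    [pm]-leaves this is [symm_mixed]. It is evaluated at [b']. *)
Lemma height_base_m b b' x : lf pm b b' -> H b x - V b x = H b' x - V b' x.
Proof.
move=> bb; suff : H b x - V b x - H b' x + V b' x = 0 by lia.
have -> : H b x - V b x - H b' x + V b' x = H b b' - V b b' - H b' b' + V b' b'.
  apply: (leaf_constant bif (F := fun x => H b x - V b x - H b' x + V b' x)).
    move=> y z yz; have yz' : lf pp y z := Or32 _ _ yz.
    by rewrite !(height_lf _ yz') !(quad_lf bif _ yz').
  move=> y z yz; have yz' : lf pm y z := Or32 _ _ yz.
  have := height_lfm b yz'; have := height_lfm b' yz';
    have := symm_mixed yz' bb.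
  rewrite /symm; lia.
rewrite (height_line bb) height_self.
have := symm_same bb; have := symm_same (lf_refl pm b').
rewrite /symm (same_sym pp b' b) (same_true (lf_refl pp b')); lia.
Qed.

(** The sum of the integral parts of a number and of its opposite. Both sides are followed as [b]
    moves away from [a]. *)
Lemma height_antisym a b : H a b + H b a = same a b - 1.
Proof.
suff : H a b + H b a - same b a = -1 by rewrite (same_sym pp a b); lia.
have -> : H a b + H b a - same b a = H a a + H a a - same a a.
  apply: (leaf_constant bif (F := fun b => H a b + H b a - same b a)) => y z yz.
    have yz' : lf pp y z := Or32 _ _ yz.
    by rewrite (height_lf a yz') (height_eq yz') (same_lf bif a yz').
  have yz' : lf pm y z := Or32 _ _ yz.
  have := height_lfm a yz'; have := height_base_m a yz'; lia.
by rewrite height_self (same_true (lf_refl pp a)).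
Qed.

(** Clear in a chart at the crossing; inside a chart the property slides along horizontals, and
    connectedness of the [pp]-leaf carries it from [u] to [z]. *)
Lemma saturation_nbhs m u z : lf pm m u -> lf pp u z ->
  \forall w \near z, exists2 v, lf pp w v & lf pm m v.
Proof.
move=> mu uz; pose S := [set w | exists2 v, lf pp w v & lf pm m v].
have spread (psi : R * R -> P) s s' t : box_chart pp pm psi ->
    nbhs (psi (s, t)) S -> nbhs (psi (s', t)) S.
  move=> ch nS.
  have : nbhs (s, t) (psi @^-1` S) := chart_continuous ch nS.
  move=> /nbhs_boxP [e e0 He].
  have : nbhs (s', t) [set w : R * R | `|t - w.2| < e].
    by apply/nbhs_boxP; exists e.
  move=> /(chart_nbhs ch); apply: filterS => _ [[a b] /= hb <-].
  have [|//|v bv mv] := He (s, b); first by rewrite subrr normr0.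
  by exists v => //; apply: (lf_trans linesP) bv; exact: chart_lf_p ch.
suff nzu : nbhs z S = nbhs u S.
  change (nbhs z S); rewrite nzu.
  have [psi [[s t] [ch e]]] := bif_chart bif u.
  have := chart_nbhs_range (s, t) ch; rewrite e;
    apply: filterS => _ [[a b] _ <-].
  exists (psi (s, b)); first exact: chart_lf_p ch.
  by apply: (lf_trans linesM mu); rewrite -e; exact: chart_lf_m ch.
suff loc y y' : pp y y' -> nbhs y S = nbhs y' S by case: uz => [->//|/loc|/loc].
apply: (lf_constant (F := fun y => nbhs y S) linesP) => {}y.
have [psi [[s t] [ch e]]] := bif_chart bif y.
have [W Wn WP] := chart_nbhs_m fib (t, s) (box_chart_swap ch).
rewrite /= e in Wn WP; apply: filterS Wn => w Ww yw.
have [s' <-] := WP w Ww yw; rewrite /swap /= -e.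
by apply/propext; split; exact: spread.
Qed.

(** * Leaves whose positive end is passed between two points of a leaf of F- *)

Section wedge.
Variables (m b : P).
Hypothesis mb : pm m b.

(** A leaf whose positive end is passed when moving from [m] up to [b] either crosses the [pm]-leaf
    of [m] or lies in this region. *)
Definition wedge : set P := up m `&` dn b `&` ri m.

Lemma open_wedge : open wedge.
Proof.
by apply: openI; [apply: openI|];
  [exact: (open_above bif)|exact: (open_below bif)|exact: (open_above fib)].
Qed.

Let lmb : lf pm m b := Or32 _ _ mb.

Lemma quad_wedge a : wedge a -> V m a = 1 /\ V b a = 0.
Proof.
move=> [[ua da] ra]; split; first by apply: quad_true; [exact: mr_right|left].
by apply: quad_false => -[_]; exact: dn_upperN.
Qed.

Lemma wedge_quad a : V m a = 1 -> V b a = 0 ->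
  (exists2 u, lf pp a u & lf pm m u) \/ wedge a.
Proof.
case: (quadP m a) => -[-> //] [ma ua] _; case: (quadP b a) => -[-> //] nb _.
have [|ra] := meets_rightE bif ma; first by left.
right; split; last exact: (ra _ (lf_refl _ _)).
split; last by apply: upperN => ba; apply: nb; split=> //; exact: mr_m ma.
case: ua => // ma'; exfalso.
have := above_nlf fib (ra m (lf_sym ma')); apply; exact: lf_refl.
Qed.

(** The crossing [u] is at or above [m] and strictly below [b], so [H m u] is 0. Since [quad _ a] is
    monotone along the [pm]-leaf and equal at [m] and [b], it has the same value at [u], and moving
    the base from [m] to [u] changes nothing. *)
Lemma height_crossing a c u : V m a = V b a -> V m c = 1 -> V b c = 0 ->
  lf pp c u -> lf pm m u -> H c a = H m a - H m c.
Proof.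
move=> mab mc1 bc0 cu mu.
rewrite (height_eq cu) (height_lf m cu) (height_line mu).
have [mu' ub] : (u = m \/ pm m u) /\ pm u b.
  case: (quadP m c) mc1 => -[-> //] [mc ucc] _;
    case: (quadP b c) bc0 => -[-> //] nb _.
  have bu : dn b u.
    apply: upperN => bu; apply: nb; split; first exact: mr_m mc.
    by apply: (upper_lfP bif (lf_sym cu)).
  split; last first.
    by rewrite -(below_crossing bif (lf_refl pp b)) //;
      exact: (lf_trans linesM (lf_sym lmb)).
  have [h|h] := upper_lfP bif cu ucc; last by left;
    exact: (cross_once bif h mu).
  by right; rewrite -(above_crossing bif (lf_refl pp m)).
have -> : same u m - V u m = 0.
  case: mu' => [->|mu'].
    by rewrite same_true ?quad_true ?subrr //; [exact/mr_self/lf_refl|right;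
      exact: lf_refl|exact: lf_refl].
  rewrite same_false ?quad_false ?subrr //.
    by move=> [_]; apply: dn_upperN; exact: (below_prev bif).
  by move=> /lf_sym; exact: (above_nlf bif (above_next bif mu')).
have := height_base_m a mu; have := quad_mono a ub.
have : V u a <= V m a by case: mu' => [->//|]; exact: quad_mono.
rewrite mab; move: (V u a) (V m a) (V b a) (H m a) (H u a) => ? ? ? ? ?; lia.
Qed.

(** If the end of [a] were passed between [q] and [q'], it would be passed between [m] and [b] as
    well. *)
Lemma wedge_left a q q' : V m a = V b a -> wedge q -> wedge q' -> pm q q' ->
  le q m -> V q a = V q' a.
Proof.
move=> mab [[um db] rm] [[um' db'] rm'] qq qm.
have lqq : lf pm q q' := Or32 _ _ qq.
case: (quadP q a) => -[-> h]; case: (quadP q' a) => -[-> h'] //; last first.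
  by exfalso; apply: h; split; [apply: mr_m h'.1;
    exact: lf_sym|exact: (upper_mono bif qq) h'.2].
exfalso; case: h => -[u au qu] qa.
have qa' : dn q' a.
  by apply: upperN => h; apply: h'; split=> //; apply: (mr_m lqq); exists u.
have qb : le q b by exact: (below_lf fib qm).
have ma : V m a = 1.
  apply: quad_true; first by exists u => //; left;
    exact: (upper_above fib rm qm).
  have [qm'|qm'|qm'] := sideP pp pm q m.
  - have n v : lf pp m v -> ~ lf pm q v.
      move=> mv qv; have vq := lf_sym qv.
      have : pm v q by rewrite -(above_crossing bif mv vq).
      apply: (prec_asym linesM).
      by rewrite -(above_crossing bif (lf_refl pp q) qv);
        exact: (above_lf bif qm').
    have fup w : lf pm q w -> up m w by move=> qw; exact: (m_above qw n um).
    apply: contrapT => /upperN da.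
    have sub : dnc m `<=` le q.
      apply: (connected_below fib (connected_lower bif (x := m)) _ _ qm).
        by move=> w hw qw; move: (fup w qw); rewrite -(lowerC bif).
      by right; exact: lf_refl.
    have lu : le q u by apply: sub; left; exact: (below_lf bif da).
    exact: lu qu.
  - by exfalso; have := above_nlf bif um; apply; exact: lf_sym.
  - by left; exact: (upper_above bif um qm').
have ba : V b a = 0.
  apply: quad_false => -[_ uba].
  have [qb'|qb'|qb'] := sideP pp pm q' b.
  - have : dn b a by apply: (lower_below bif db' qb'); left.
    by move/dn_upperN.
  - by have := below_nlf db'; apply; exact: lf_sym.
  - have n v : lf pp b v -> ~ lf pm q' v.
      move=> bv qv; have vq := lf_sym qv.
      have : pm q' v by rewrite -(below_crossing bif bv vq).
      apply: (prec_asym linesM).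
      by rewrite -(below_crossing bif (lf_refl pp q') qv);
        exact: (below_lf bif qb').
    have fdn w : lf pm q' w -> dn b w by move=> qw; exact: (m_below qw n db').
    have sub : upc b `<=` le q.
      apply: (connected_below fib (connected_upper bif (x := b)) _ _ qb).
        move=> w hw qw; have dw : dn b w by apply: fdn;
          exact: (lf_trans linesM (lf_sym lqq)).
        exact: dw hw.
      by right; exact: lf_refl.
    have lu : le q u by apply: sub; exact: (upper_lfP bif au).
    exact: lu qu.
by move: mab; rewrite ma ba.
Qed.

(** Everything that a leaf through [q] separates from [m] lies in the wedge, and [a] does not; hence
    the quadrant at [q] cannot distinguish [a] from [m]. *)
Lemma wedge_right a q : V m a = V b a -> wedge q -> ri q m -> V q a = V q m.
Proof.
move=> mab [[um db] rm] qm.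
have nw : ~ wedge a by move=> /quad_wedge [ma ba]; move: mab; rewrite ma ba.
have n v : lf pp q v -> ~ lf pm m v by move=> qv mv;
  exact: (right_right_disj rm qm qv mv).
have qb : ri q b by exact: (above_lf fib qm).
have bq : ri b q by rewrite -(above_eq fib lmb).
have nl x z : ri q x -> ri x q -> lec q z -> ~ lf pp x z.
  move=> qx xq qz xz.
  have nx v : lf pp x v -> ~ lf pm q v by move=> xv qv;
    exact: (right_right_disj qx xq xv qv).
  have := connected_above fib (@lf_connected _ _ _ linesP x) nx (lf_refl pp x)
    qx xz.
  by rewrite -(lowerC fib).
have qlec : lec q q by right; exact: lf_refl.
have qlower : dnc q q by right; exact: lf_refl.
have qupper : upc q q by right; exact: lf_refl.
have mra : mr q a.
  apply: contrapT => nmr; apply: nw.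
  have qa : lec q a.
    have [h|h|h] := sideP pm pp q a; last by left.
      by exfalso; apply: nmr; exact: mr_right.
    by right.
  split; last exact: (lower_above fib rm qm).
  split.
    exact: (connected_above bif (connected_lower fib (x := q)) (fun z =>
      nl m z qm rm) qlec um).
  exact: (connected_below bif (connected_lower fib (x := q)) (fun z =>
    nl b z qb bq) qlec db).
apply: quad_equiv; split=> -[_ qa]; (split; first by [|exact: mr_right]).
  have [h|h|qm'] := sideP pp pm q m; [by left|by right|].
  exfalso; apply: nw.
  have fdn z : lf pm m z -> dn q z by move=> mz; exact: (m_below mz n qm').
  split; [split|].
  - exact: (upper_above bif um qm').
  - exact: (upper_below bif db (fdn b lmb)).
  - apply: (connected_above fib (connected_upper bif (x :=
    q)) _ qupper rm) => // z hz mz.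
    by have d := fdn z mz; exact: d hz.
have [qm'|h|h] := sideP pp pm q m; last by exfalso; exact: h qa.
  have fup z : lf pm m z -> up q z by move=> mz; exact: (m_above mz n qm').
  apply: contrapT => /upperN da; have {}da : dnc q a by left.
  apply: nw; split; [split|].
  - exact: (lower_above bif um qm').
  - exact: (lower_below bif db (fup b lmb)).
  - apply: (connected_above fib (connected_lower bif (x :=
    q)) _ qlower rm) => // z hz mz.
    by move: (fup z mz); rewrite -(lowerC bif).
by exfalso; have := above_nlf bif um; apply; exact: lf_sym.
Qed.

(** [F] is locally constant on the wedge and vanishes on the leaves that cross the [pm]-leaf of [m].
    Near the boundary of the wedge its points lie on such leaves, so the set where [F] is nonzero is
    open and closed; it misses [m]. *)
Lemma wedge_height a c : V m a = V b a -> V m c = 1 -> V b c = 0 ->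
  H c a = H m a - H m c.
Proof.
move=> mab mc bc.
pose F q := H m a - H m q - H q a.
have Fcross q u : wedge q -> lf pp q u -> lf pm m u -> F q = 0.
  move=> /quad_wedge [mq bq] qu mu.
  by rewrite /F (height_crossing mab mq bq qu mu) subrr.
have nsame q : wedge q -> same q m = 0.
  by move=> [[um _] _]; apply: same_false => /lf_sym; exact: (above_nlf bif).
have Fpm q q' : wedge q -> wedge q' -> pm q q' -> F q = F q'.
  move=> wq wq' qq; have lqq : lf pm q q' := Or32 _ _ qq.
  (* The left side is the change of [H m q], the right side the opposite of that of [H q a]; the
     [same] terms vanish in the wedge. *)
  suff : V q m - V q' m = V q a - V q' a.
    have := height_lfm m lqq; have := height_base_m a lqq.
    rewrite !nsame // /F; lia.
  have [qm|qm|qm] := sideP pm pp q m.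
  - rewrite (wedge_right mab wq qm) (wedge_right mab wq') //.
    by rewrite -(above_eq fib lqq).
  - by exfalso; have := above_nlf fib wq.2; apply; exact: lf_sym.
  - rewrite (wedge_left mab wq wq' qq qm) subrr.
    have zero x : wedge x -> le x m -> V x m = 0.
      move=> [[um _] _] xm; apply: quad_false => -[/(mr_left xm)[u mu xu] xum].
      have ux := lf_sym xu.
      have : pm u x by rewrite -(above_crossing bif mu ux).
      have [h|h] := upper_lfP bif mu xum.
        by apply/(prec_asym linesM);
          rewrite -(above_crossing bif (lf_refl pp x) xu).
      rewrite (cross_once bif h xu); exact: (prec_irr linesM).
    by rewrite !zero // -(below_eq fib lqq).
have Floc q : wedge q -> \forall w \near q, wedge w /\ F w = F q.
  move=> wq; have [psi [[s t] [ch e]]] := bif_chart bif q.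
  have : nbhs (s, t) (psi @^-1` wedge).
    apply: (chart_continuous ch); rewrite e.
    by apply: open_nbhs_nbhs; split=> //; exact: open_wedge.
  move=> /nbhs_boxP [d d0 He].
  have : nbhs (s, t) [set w : R * R | `|s - w.1| < d /\ `|t - w.2| < d].
    by apply/nbhs_boxP; exists d.
  move=> /(chart_nbhs ch); rewrite e;
    apply: filterS => _ [[s' t'] /= [h1 h2] <-].
  have w1 : wedge (psi (s', t')) by exact: (He (s', t')).
  split=> //.
  have w2 : wedge (psi (s', t)) by apply: (He (s', t)) => //=;
    rewrite subrr normr0.
  have -> : F q = F (psi (s', t)).
    have l : lf pp q (psi (s', t)) by rewrite -e; exact: chart_lf_p ch.
    by rewrite /F (height_lf _ l) (height_eq l).
  have [tt|tt|->] := ltgtP t t' => //; last by apply: Fpm => //;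
    rewrite (chart_m ch).
  by apply/esym/Fpm => //; rewrite (chart_m ch).
have F0 q : wedge q -> F q = 0.
  move=> wq; apply: contrapT => Fq.
  pose D := [set q | wedge q /\ F q <> 0].
  have oD : open D.
    rewrite openE => z [wz Fz]; rewrite /interior.
    by apply: filterS (Floc z wz) => w [ww Fw]; split=> //; rewrite Fw.
  have cD : closed D.
    rewrite -openC openE => z nz; rewrite /interior.
    have [wz|wz] := pselect (wedge z).
      apply: filterS (Floc z wz) => w [_ Fw] [_]; rewrite Fw => Fz; exact: nz.
    have out (A : set P) : open A -> A z -> (forall w, A w -> ~ wedge w) ->
        nbhs z (~` D).
      move=> oA Az nA; have := open_nbhs_nbhs (conj oA Az).
      by apply: filterS => w Aw [/(nA _ Aw)].
    have [h1|h1] := pselect (dn m z).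
      by apply: (out (dn m)) => //; [exact: (open_below bif)|move=>
        w dw [[/(above_nbelow)]]].
    have [h2|h2] := pselect (up b z).
      by apply: (out (up b)) => //; [exact: (open_above bif)|move=>
        w uw [[_ /(above_nbelow uw)]]].
    have [h3|h3] := pselect (le m z).
      by apply: (out (le m)) => //; [exact: (open_below fib)|move=>
        w lw [_ /(above_nbelow)]].
    (* Such a [z] lies on the leaf of [m], on that of [b], or on the [pm]-leaf of [m]. *)
    have [u mu uz] : exists2 u, lf pm m u & lf pp u z.
      have [h|h|//] := sideP pp pm m z; last by exists m => //; exact: lf_refl.
      have [//|h'|h'] := sideP pp pm b z; first by exists b.
      have [k|k|//] := sideP pm pp m z; last by exists z => //; exact: lf_refl.
      by exfalso; apply: wz.
    apply: filterS (saturation_nbhs mu uz) => w [v wv mv] [ww]; apply.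
    exact: Fcross ww wv mv.
  have Dq : D q by [].
  have : D m by rewrite (connected_clopen (plane_connected (bif_plane bif)) oD
    cD Dq).
  by move=> [[[/(above_nlf bif)]]]; have := lf_refl pp m.
have [[u cu mu]|wc] := wedge_quad mc bc; first exact: height_crossing mu.
by have := F0 c wc; rewrite /F; lia.
Qed.

End wedge.

Definition triple a b c : int := H a c - H a b - H b c.

(** The middle variable moves. Away from the leaf of [a], a step from [y] up to [z] changes the
    value only if exactly one of the ends of [a] and [c] is passed; [wedge_height] then gives the
    value at [y]: 0 if it is the end of [c], and the step adds 1; 1 if it is the end of [a], and the
    step subtracts 1. *)
Lemma triple_bounds a b c : 0 <= triple a b c <= 1.
Proof.
have <- : (0 <= triple a a c <= 1) = (0 <= triple a b c <= 1).
  apply: (leaf_constant bif (F := fun b => 0 <= triple a b c <= 1)) => y z yz.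
    have yz' : lf pp y z := Or32 _ _ yz.
    by rewrite /triple (height_lf a yz') (height_eq yz').
  have lyz : lf pm y z := Or32 _ _ yz.
  have same1 x : lf pp x a -> triple a x c = 0.
    move=> xa; rewrite /triple (height_eq xa) (height_lf a xa) height_self; lia.
  have Tyz : triple a z c - triple a y c =
      V z a - same z a - V y a + same y a + V y c - V z c.
    have := height_lfm a lyz; have := height_base_m c lyz; rewrite /triple; lia.
  have bool01 x x' : V x x' = 0 \/ V x x' = 1.
    by case: (quadP x x') => -[-> _]; [right|left].
  have mono x := quad_mono x yz.
  have [ya|ya] := pselect (lf pp y a).
    have nza : ~ lf pp z a.
      move=> za; have := above_nlf bif (above_next bif yz); apply.
      exact: (lf_trans linesP ya (lf_sym za)).
    have Vya : V y a = 1.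
      by rewrite -(quad_lf bif y ya) quad_true //; [apply: mr_self|right];
        exact: lf_refl.
    have Vza : V z a = 0.
      rewrite -(quad_lf bif z ya) quad_false // => -[_].
      by apply: dn_upperN; exact: (below_prev bif).
    move: Tyz; rewrite (same1 y) // Vya Vza (same_true ya) (same_false nza).
    by have := mono c; have := bool01 y c; have := bool01 z c; lia.
  have [za|za] := pselect (lf pp z a).
    have Vza : V z a = 1.
      by rewrite -(quad_lf bif z za) quad_true //; [apply: mr_self|right];
        exact: lf_refl.
    move: Tyz; rewrite (same1 z) // Vza (same_true za) (same_false ya).
    have := mono a; have := mono c; have := bool01 y a; have := bool01 y c;
      have := bool01 z c; lia.
  move: Tyz; rewrite (same_false ya) (same_false za) => Tyz.
  have [e|e] := eqVneq (V y a) (V z a); have [e'|e'] := eqVneq (V y c) (V z c).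
  - by move: Tyz; rewrite e e'; lia.
  - have [yc zc] : V y c = 1 /\ V z c = 0.
      by have := mono c; have := bool01 y c; have := bool01 z c; lia.
    have := wedge_height yz e yc zc.
    have ac : ~ lf pp a c.
      by move=> ac; move: e e'; rewrite !(quad_lf bif _ ac) => ->; rewrite eqxx.
    have := height_antisym a c; have := height_antisym a y.
    rewrite (same_false ac) (same_false (fun h => ya (lf_sym h))).
    move: Tyz; rewrite /triple e yc zc; lia.
  - have [ya1 za0] : V y a = 1 /\ V z a = 0.
      by have := mono a; have := bool01 y a; have := bool01 z a; lia.
    have := wedge_height yz e' ya1 za0.
    have := height_antisym a y.
    rewrite (same_false (fun h => ya (lf_sym h))).
    move: Tyz; rewrite /triple e' ya1 za0; lia.
  - have [[yc zc] [ya1 za0]] : (V y c = 1 /\ V z c = 0) /\ (V y a = 1 /\ V z a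
    = 0).
      by have := mono a; have := bool01 y a; have := bool01 z a;
        have := mono c; have := bool01 y c; have := bool01 z c; lia.
    by move: Tyz; rewrite yc zc ya1 za0; lia.
by rewrite /triple height_self; lia.
Qed.

End cocycle.

(** * From linear orders to homeomorphisms of the line *)

Lemma half_pow_small (R : realType) (d : R) : 0 < d -> exists N, 2^-1 ^+ N < d.
Proof.
move=> d0; exists (Num.bound d^-1); rewrite exprVn.
rewrite invf_plt ?posrE ?exprn_gt0 //.
apply: lt_trans (archi_boundP _) _; first by rewrite invr_ge0 ltW.
by rewrite -natrX ltr_nat ltn_expl.
Qed.

Section order_to_real.
Variables (R : realType) (T : Type) (le : T -> T -> Prop) (sigma : nat -> R ->
  T).
Hypothesis le_total : forall x y, le x y \/ le y x.
Hypothesis le_tr : forall x y z, le x y -> le y z -> le x z.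
Hypothesis sigma_le : forall n s t, s < t -> le (sigma n s) (sigma n t).
Hypothesis sigma_lt : forall n s t, s < t -> ~ le (sigma n t) (sigma n s).

Let le_self x : le x x. Proof. by case: (le_total x x). Qed.

(* [phi n x] is the place where [x] cuts the arc [sigma n].  Cutting a segment
   leaves no gap, and neither does the weighted sum [e] of these places. *)
Let below_set n x : set R :=
  [set t | 0 <= t <= 1 /\ (t = 0 \/ le (sigma n t) x)].

Let phi n x : R := sup (below_set n x).

(** The clause [t = 0] keeps the set nonempty when [x] precedes the whole arc. *)
Let below_set0 n x : below_set n x 0. Proof. by split; [lra|left]. Qed.

Let ub_below n x : has_ubound (below_set n x).
Proof. by exists 1 => t [/andP[]]. Qed.

Let phi_ge0 n x : 0 <= phi n x.
Proof. exact: ub_le_sup. Qed.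

Let phi_le1 n x : phi n x <= 1.
Proof. by apply: ge_sup => [|t [/andP[]] //]; exists 0. Qed.

Let phi_mono n x y : le x y -> phi n x <= phi n y.
Proof.
move=> xy; apply: ge_sup; first by exists 0.
move=> t [t01 h]; apply: ub_le_sup => //; split=> //.
by case: h => h; [left|right; exact: le_tr xy].
Qed.

Let phi_lb n t x : 0 <= t <= 1 -> le (sigma n t) x -> t <= phi n x.
Proof. by move=> t01 h; apply: ub_le_sup => //; split=> //; right. Qed.

Let phi_ub n t x : 0 <= t <= 1 -> le x (sigma n t) -> phi n x <= t.
Proof.
move=> t01 h; apply: ge_sup; first by exists 0.
move=> s [s01 [->|hs]]; first by case/andP: t01.
rewrite leNgt; apply/negP => ts; apply: (sigma_lt (n := n) ts).
exact: le_tr h.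
Qed.

Let phi_lt n x y : phi n x < phi n y -> exists s t,
  [/\ 0 <= s, s < t, t <= 1, le x (sigma n s) & le (sigma n t) y].
Proof.
move=> xy; have x0 := phi_ge0 n x; have y1 := phi_le1 n y.
pose s := (2 * phi n x + phi n y) / 3; pose t := (phi n x + 2 * phi n y) / 3.
exists s, t; rewrite /s /t; split; try lra.
  have [h|//] := le_total (sigma n s) x.
  suff : s <= phi n x by rewrite /s; lra.
  by apply: phi_lb => //; rewrite /s; lra.
have supy : has_sup (below_set n y) by split=> //; exists 0.
have ty : 0 < phi n y - t by rewrite /t; lra.
have [r [r01 hr] tr] := sup_adherent ty supy.
move: tr; rewrite -/(phi n y) => tr; have {}tr : t < r by lra.
case: hr => [r0|hr]; first by move: tr; rewrite r0 /t; lra.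
by apply: le_tr hr; exact: sigma_le.
Qed.

Let partial N x : R := \sum_(0 <= n < N) phi n x * 2^-1 ^+ n.+1.

Let partialS N x : partial N.+1 x = partial N x + phi N x * 2^-1 ^+ N.+1.
Proof. by rewrite /partial big_nat_recr. Qed.

Let pow_gt0 n : 0 < 2^-1 ^+ n :> R.
Proof. by rewrite exprn_gt0 // invr_gt0. Qed.

Let powS n : 2^-1 ^+ n = 2^-1 ^+ n.+1 + 2^-1 ^+ n.+1 :> R.
Proof. rewrite exprS; lra. Qed.

Let partial_mono N M x : (N <= M)%N -> partial N x <= partial M x.
Proof.
move=> /subnK <-; elim: (M - N)%N => [|k IH]; first by rewrite add0n.
rewrite addSn partialS (le_trans IH) // lerDl mulr_ge0 // ltW //.
Qed.

Let partial_tail N M x : (N <= M)%N ->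
  partial M x <= partial N x + 2^-1 ^+ N - 2^-1 ^+ M.
Proof.
move=> /subnK <-; elim: (M - N)%N => [|k IH]; first by rewrite add0n; lra.
rewrite addSn partialS; have := powS (k + N).
have : phi (k + N) x * 2^-1 ^+ (k + N).+1 <= 2^-1 ^+ (k + N).+1.
  by rewrite ler_piMl // ltW.
move: IH; lra.
Qed.

Let e x : R := sup (range (partial ^~ x)).

Let partial_ub N x : [set r | exists M,
  r = partial M x] `<=` [set r | r <= partial N x + 2^-1 ^+ N].
Proof.
move=> _ [M ->] /=; have := pow_gt0 N; have := pow_gt0 M.
have [NM|/ltnW MN] := leqP N M; first by have := partial_tail x NM; lra.
by have := partial_mono x MN; lra.
Qed.

Let e_ub N x : e x <= partial N x + 2^-1 ^+ N.
Proof.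
apply: ge_sup; first by exists (partial 0 x), 0%N.
by move=> _ [M _ <-]; apply: partial_ub; exists M.
Qed.

Let e_lb N x : partial N x <= e x.
Proof.
apply: ub_le_sup; last by exists N.
exists (partial 0 x + 2^-1 ^+ 0) => _ [M _ <-]; apply: partial_ub; by exists M.
Qed.

Let partial_le N x y : le x y -> partial N x <= partial N y.
Proof.
move=> xy; apply: ler_sum => n _; rewrite ler_wpM2r ?phi_mono // ltW //.
Qed.

Let e_mono x y : le x y -> e x <= e y.
Proof.
move=> xy; apply: ge_sup; first by exists (partial 0 x), 0%N.
by move=> _ [N _ <-]; apply: le_trans (e_lb N y); exact: partial_le.
Qed.

Let e_lt x y k : le x y -> phi k x < phi k y -> e x < e y.
Proof.
move=> xy xyk; pose d := (phi k y - phi k x) * 2^-1 ^+ k.+1.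
have d0 : 0 < d by rewrite mulr_gt0 ?subr_gt0.
have gap N : (k < N)%N -> partial N x + d <= partial N y.
  elim: N => // N IH; rewrite ltnS leq_eqVlt !partialS => /orP[/eqP <-|/IH h].
    by have := partial_le k xy; rewrite /d; lra.
  have : phi N x * 2^-1 ^+ N.+1 <= phi N y * 2^-1 ^+ N.+1.
    by rewrite ler_wpM2r ?phi_mono // ltW.
  by move: h; lra.
have [N Nd] := half_pow_small d0.
have h1 := gap _ (leq_maxr N k.+1).
have h2 := e_ub (maxn N k.+1) x; have h3 := e_lb (maxn N k.+1) y.
have : 2^-1 ^+ maxn N k.+1 <= 2^-1 ^+ N :> R.
  by rewrite ler_wiXn2l ?leq_maxl // ?invr_ge0 // invf_le1 ?ler1n.
move: h1 h2 h3; lra.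
Qed.

(** Assume a gap. Just beyond the supremum of [phi n] over the elements under the gap, the arc has a
    point, necessarily over the gap: so the two sides come within [d] of each other in each
    coordinate. Totality of the order yields one pair that works for the first [N] coordinates, and
    then [e] differs by less than [2 * d], whereas the gap has length [3 * d]. *)
Let e_gapless u v x0 y0 : u < v -> e x0 <= u -> v <= e y0 ->
  exists z, u < e z /\ e z < v.
Proof.
move=> uv x0u vy0; apply: contrapT => gap.
have AB z : e z <= u \/ v <= e z.
  have [h|h] := leP (e z) u; first by left.
  have [h'|h'] := leP v (e z); first by right.
  by exfalso; apply: gap; exists z.
pose d := (v - u) / 3; have d0 : 0 < d by rewrite /d; lra.
have one n : exists x y, [/\ e x <= u, v <= e y & phi n y - phi n x <= d].
  pose A := [set phi n x | x in [set x | e x <= u]].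
  have A0 : A !=set0 by exists (phi n x0), x0.
  have ubA : has_ubound A by exists 1 => _ [x _ <-].
  have d20 : 0 < d / 2 by lra.
  have [_ [x xu <-] hx] := sup_adherent d20 (conj A0 ubA).
  have sA : phi n x <= sup A by apply: ub_le_sup => //; exists x.
  have x_ge0 := phi_ge0 n x.
  have [s1|s1] := leP 1 (sup A).
    exists x, y0; split=> //; have := phi_le1 n y0; lra.
  pose t := Num.min (sup A + d / 2) 1.
  have [t1 t2 t3] : [/\ sup A < t, t <= sup A + d / 2 & t <= 1].
    by rewrite /t lt_min !ge_min !lexx ?orbT; split=> //; lra.
  have t01 : 0 <= t <= 1 by lra.
  have phit : phi n (sigma n t) = t.
    by apply/le_anti/andP; split; [exact: phi_ub|exact: phi_lb].
  have [h|h] := AB (sigma n t).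
    suff : t <= sup A by lra.
    by rewrite -phit; apply: ub_le_sup => //; exists (sigma n t).
  by exists x, (sigma n t); rewrite phit; split=> //; lra.
have all N : exists x y, [/\ e x <= u, v <= e y &
    forall n, (n < N)%N -> phi n y - phi n x <= d].
  elim: N => [|N [x [y [xu vy h]]]]; first by exists x0, y0.
  have [x' [y' [xu' vy' h']]] := one N.
  have [x2 [x2u [xx2 x'x2]]] : exists x2, e x2 <= u /\ (le x x2 /\ le x' x2).
    by have [c|c] := le_total x x'; [exists x'|exists x].
  have [y2 [vy2 [y2y y2y']]] : exists y2, v <= e y2 /\ (le y2 y /\ le y2 y').
    by have [c|c] := le_total y y'; [exists y|exists y'].
  exists x2, y2; split=> // n; rewrite ltnS leq_eqVlt => /orP[/eqP ->|/h hn].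
    by have := phi_mono N x'x2; have := phi_mono N y2y'; lra.
  by have := phi_mono n xx2; have := phi_mono n y2y; lra.
have [N Nd] := half_pow_small d0.
have [x [y [xu vy h]]] := all N.
have : partial N y - partial N x <= d * (1 - 2^-1 ^+ N).
  elim: N {Nd} h => [|N IH] h; first by rewrite /partial !big_geq // expr0; lra.
  have {}IH := IH (fun n hn => h n (ltnW hn)).
  have := h N (ltnSn N); rewrite -(ler_pM2r (pow_gt0 N.+1)) mulrBl => hN.
  rewrite !partialS; have := powS N; move: IH hN; nra.
have := e_ub N y; have := e_lb N x; have := pow_gt0 N; rewrite /d in d0 Nd *;
  nra.
Qed.

Lemma order_to_real : exists e : T -> R,
  [/\ forall x y, le x y -> e x <= e y,
      forall x y, e x < e y <-> exists n s t,
        [/\ 0 <= s, s < t, t <= 1, le x (sigma n s) & le (sigma n t) y]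
    & forall u v x y, u < v -> e x <= u -> v <= e y ->
        exists z, u < e z /\ e z < v].
Proof.
exists e; split=> [x y|x y|u v x y]; [exact: e_mono| |exact: e_gapless].
split=> [xy|[n [s [t [s0 st t1 xs ty]]]]].
  have [k hk] : exists k, phi k x < phi k y.
    apply: contrapT => n; suff : e y <= e x by lra.
    apply: ge_sup; first by exists (partial 0 y), 0%N.
    move=> _ [N _ <-]; apply: le_trans (e_lb N x); apply: ler_sum => k _.
    apply: ler_wpM2r; first by rewrite ltW.
    by rewrite leNgt; apply/negP => h; apply: n; exists k.
  by have [s [t h]] := phi_lt hk; exists k, s, t.
apply: (e_lt (k := n)); first exact: le_tr (le_tr xs (sigma_le n st)) ty.
have : phi n x <= s by apply: phi_ub => //; lra.
have : t <= phi n y by apply: phi_lb => //; lra.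
lra.
Qed.

End order_to_real.

Lemma increasing_bijection_continuous (R : realType) (f g : R -> R) :
  {homo f : x y / x < y} -> cancel f g -> cancel g f -> continuous f.
Proof.
move=> fm fK gK.
have gm : {homo g : x y / x < y}.
  move=> x y xy; have [//|h|h] := ltgtP (g x) (g y).
    by have := fm _ _ h; rewrite !gK; lra.
  by move: xy; rewrite -(gK x) -(gK y) h ltxx.
move=> t A /nbhs_distP [d d0 dA]; apply/nbhs_distP.
have h1 : g (f t - d) < t by rewrite -[ltRHS]fK; apply: gm; lra.
have h2 : t < g (f t + d) by rewrite -[ltLHS]fK; apply: gm; lra.
exists (Num.min (t - g (f t - d)) (g (f t + d) - t)).
  by rewrite lt_min !subr_gt0 h1.
move=> q; rewrite lt_min !ltr_distlC => /andP[/andP[q1 _] /andP[_ q2]].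
have {}q1 : f t - d < f q by rewrite -[ltLHS]gK; apply: fm; lra.
have {}q2 : f q < f t + d by rewrite -[ltRHS]gK; apply: fm; lra.
by apply: dA; rewrite ltr_distlC q1.
Qed.

(** * Extension to the line of an action on an image without gaps *)

Section dense_action.
Variables (R : realType) (T : Type) (e : T -> R) (G : groupType) (act : G -> T
  -> T).
Hypothesis gapless : forall u v x y, u < v -> e x <= u -> v <= e y ->
  exists z, u < e z /\ e z < v.
Hypothesis act1 : forall x, act 1%g x = x.
Hypothesis actM : forall (g h : G) x, act (g * h)%g x = act g (act h x).
Hypothesis act_lt : forall g x y, e x < e y -> e (act g x) < e (act g y).

Let act_le g x y : e x <= e y -> e (act g x) <= e (act g y).
Proof.
move=> xy; rewrite leNgt; apply/negP => /(act_lt g^-1%g).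
by rewrite -!actM mulVg !act1; lra.
Qed.

(** The convex hull of the image of [e]; absence of gaps makes the image meet every open interval
    between two of its points. *)
Let hull t := exists x y, e x <= t /\ t <= e y.

Let ext g t : R := sup [set e (act g x) | x in [set x | e x <= t]].

Let ext_ub g t x y : e x <= t -> t <= e y ->
  has_sup [set e (act g x) | x in [set x | e x <= t]].
Proof.
move=> xt ty; split; first by exists (e (act g x)), x.
by exists (e (act g y)) => _ [z /= zt <-]; apply: act_le; lra.
Qed.

Let ext_ge g t x : hull t -> e x <= t -> e (act g x) <= ext g t.
Proof.
move=> [_ [y [_ ty]]] xt; apply: ub_le_sup; last by exists x.
by have [_] := ext_ub g xt ty.
Qed.

Let ext_le g t y : hull t -> t <= e y -> ext g t <= e (act g y).
Proof.
move=> [x [_ [xt _]]] ty; apply: ge_sup; first by exists (e (act g x)), x.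
by move=> _ [z /= zt <-]; apply: act_le; lra.
Qed.

Let hull_ext g t : hull t -> hull (ext g t).
Proof.
move=> ht; have [x [y [xt ty]]] := ht.
by exists (act g x), (act g y); split; [exact: ext_ge|exact: ext_le].
Qed.

Let between u v : hull u -> hull v -> u < v -> exists z, u < e z /\ e z < v.
Proof. by move=> [x [_ [xu _]]] [_ [y [_ vy]]] uv;
  exact: (gapless uv xu vy). Qed.

Let ext1 t : hull t -> ext 1%g t = t.
Proof.
move=> ht; apply/le_anti; rewrite !leNgt; apply/andP; split; apply/negP => h.
  have [z [z1 z2]] := between ht (hull_ext 1%g ht) h.
  by have := ext_le 1%g ht (ltW z1); rewrite act1; lra.
have [z [z1 z2]] := between (hull_ext 1%g ht) ht h.
by have := ext_ge 1%g ht (ltW z2); rewrite act1; lra.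
Qed.

(** Were the values distinct, some [e z] would lie strictly between them. The preimage of [z] under
    [g * h] is on one side of [t], and monotonicity is contradicted in either case. *)
Let extM g h t : hull t -> ext (g * h)%g t = ext g (ext h t).
Proof.
move=> ht; have hh := hull_ext h ht; have hg := hull_ext g hh.
have hgh := hull_ext (g * h)%g ht.
have back z : act g (act h (act (g * h)^-1%g z)) = z by
  rewrite -!actM mulgV act1.
apply/le_anti; rewrite !leNgt; apply/andP; split; apply/negP => lt.
  have [z [z1 z2]] := between hg hgh lt.
  have [zt|zt] := leP (e (act (g * h)^-1%g z)) t.
    have := ext_ge g hh (ext_ge h ht zt); rewrite back; lra.
  by have := ext_le (g * h)%g ht (ltW zt); rewrite actM back; lra.
have [z [z1 z2]] := between hgh hg lt.
have [zt|zt] := leP (e (act (g * h)^-1%g z)) t.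
  have := ext_ge (g * h)%g ht zt; rewrite actM back; lra.
by have := ext_le g hh (ext_le h ht (ltW zt)); rewrite back; lra.
Qed.

Let ext_lt g t t' : hull t -> hull t' -> t < t' -> ext g t < ext g t'.
Proof.
move=> ht ht' tt.
have [z [z1 z2]] := between ht ht' tt.
have hz : hull (e z) by exists z, z.
have [z' [z1' z2']] := between hz ht' z2.
have := ext_le g ht (ltW z1); have := ext_ge g ht' (ltW z2');
  have := act_lt g z1'.
lra.
Qed.

Lemma dense_action_extension : exists rho : G -> R -> R,
  [/\ forall g, homeo_plus (rho g),
      forall g h, rho (g * h)%g = rho g \o rho h
    & forall g x, rho g (e x) = e (act g x)].
Proof.
(* The hull is convex and preserved by [ext g], so the identity outside it fits in increasingly. *)
pose rho g t := if `[< hull t >] then ext g t else t.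
have in_ g t : hull t -> rho g t = ext g t by move=> h; rewrite /rho asboolT.
have out g t : ~ hull t -> rho g t = t by move=> h; rewrite /rho asboolF.
have rhoM g h t : rho (g * h)%g t = rho g (rho h t).
  have [ht|ht] := pselect (hull t).
    by rewrite !in_ ?extM //; exact: hull_ext.
  by rewrite (out h) // !out.
have rho1 t : rho 1%g t = t.
  by have [ht|ht] := pselect (hull t); [rewrite in_ ?ext1|rewrite out].
have rhoK g : cancel (rho g) (rho g^-1%g) by move=> t; rewrite -rhoM mulVg.
have rhoVK g : cancel (rho g^-1%g) (rho g) by move=> t; rewrite -rhoM mulgV.
have incr g : {homo rho g : x y / x < y}.
  move=> t t' tt.
  have [ht|ht] := pselect (hull t); have [ht'|ht'] := pselect (hull t').
  - by rewrite !in_ //; exact: ext_lt.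
  - rewrite in_ // out //; have [x [y [xt ty]]] := ht.
    have := ext_le g ht ty => h1; apply: le_lt_trans h1 _; rewrite ltNge.
    by apply/negP => h; apply: ht'; exists x, (act g y); split=> //; lra.
  - rewrite out // in_ //; have [x [y [xt ty]]] := ht'.
    have := ext_ge g ht' xt => h1; apply: lt_le_trans h1; rewrite ltNge.
    by apply/negP => h; apply: ht; exists (act g x), y; split=> //; lra.
  - by rewrite !out.
exists rho; split.
- move=> g; split; last exact: incr.
  split.
  + split=> // [x y _ _|y _]; first exact: (can_inj (rhoK g)).
    by exists (rho g^-1%g y) => //; exact: rhoVK.
  + apply: continuous_subspaceT.
    exact: increasing_bijection_continuous (incr g) (rhoK g) (rhoVK g).
  + exists (rho g^-1%g); first by move=> x _; exact: rhoK.
    apply: continuous_subspaceT.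
    exact: increasing_bijection_continuous (incr g^-1%g) (rhoVK g) (rhoK g).
- by move=> g h; apply/funext => t; exact: rhoM.
- move=> g x; have hx : hull (e x) by exists x, x.
  by rewrite in_ //; apply/le_anti; rewrite ext_le ?ext_ge.
Qed.

End dense_action.

(** * The linear order on the leaves *)

Section leaf_order.
Variables (R : realType) (P : topologicalType) (pp pm : P -> P -> Prop).
Hypothesis bif : bifoliation R pp pm.
Let linesP := bif_p bif.
Let linesM := bif_m bif.
Local Notation H := (height pp pm).

Definition leaf_le x y : Prop := 0 <= H x y.

Lemma leaf_le_lf x y : lf pp x y -> leaf_le x y.
Proof. by move=> h; rewrite /leaf_le (height_base_lf bif h). Qed.

Lemma leaf_le_total x y : leaf_le x y \/ leaf_le y x.
Proof.
have := height_antisym bif x y; rewrite /leaf_le.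
have [h|h] := pselect (lf pp x y); first by left; exact: leaf_le_lf.
rewrite (same_false h) => e; have [h'|h'] := leP 0 (H x y); [by left|right;
  lia].
Qed.

Lemma leaf_le_trans x y z : leaf_le x y -> leaf_le y z -> leaf_le x z.
Proof.
by rewrite /leaf_le => h1 h2; have /andP[] := triple_bounds bif x y z;
  rewrite /triple; lia.
Qed.

Lemma leaf_le_m x y : pm x y -> leaf_le x y.
Proof.
move=> xy; have [//|h] := leaf_le_total x y; exfalso.
have nyx : ~ lf pp y x.
  by move=> /lf_sym; exact: (above_nlf bif (above_next bif xy)).
have nxy : ~ lf pp x y := fun h => nyx (lf_sym h).
move: h; rewrite /leaf_le (height_line bif (Or33 _ _ xy)) (same_false nxy)
  quad_true //.
  by apply: mr_self; exact: Or32.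
by left; exact: (above_next bif).
Qed.

Lemma leaf_lt_m x y : pm x y -> ~ leaf_le y x.
Proof.
move=> xy.
have nxy : ~ lf pp x y by exact: (above_nlf bif (above_next bif xy)).
rewrite /leaf_le (height_line bif (Or33 _ _ xy)) (same_false nxy) quad_true //.
  by apply: mr_self; exact: Or32.
by left; exact: (above_next bif).
Qed.

(** Vertical segments of charts, starting at the points with rational coordinates and with lengths
    [1 / (k + 1)] in the chart; [idx] decodes the three parameters. The last clause, witnessed by a
    horizontal strip of the chart, trades arcs for open sets, which the action permutes. *)
Lemma dense_segments : exists sigma : nat -> R -> P,
  [/\ forall n s t, s < t -> pm (sigma n s) (sigma n t),
      forall O, open O -> O !=set0 ->
        exists n, forall s, 0 <= s <= 1 -> O (sigma n s)
    & forall n s t, s < t -> exists O,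
        [/\ open O, O !=set0 &
          forall p, O p -> leaf_le (sigma n s) p /\ leaf_le p (sigma n t)]].
Proof.
have [phi [g [cphi cg phiK gK]]] := bif_plane bif.
have [psi hpsi] := choice (bif_chart bif).
have [p hp] := choice hpsi.
have ch z : box_chart pp pm (psi z) by case: (hp z).
have pz z : psi z (p z) = z by case: (hp z).
pose idx n : rat * rat * nat := odflt (0, 0, 0%N) (unpickle n).
pose d n := g (ratr (idx n).1.1, ratr (idx n).1.2).
pose r n : R := (idx n).2.+1%:R^-1.
have r0 n : 0 < r n by rewrite invr_gt0 ltr0n.
exists (fun n s => psi (d n) ((p (d n)).1, (p (d n)).2 + s * r n)); split.
- by move=> n s t st; rewrite (chart_m (ch _)) ltrD2l ltr_pM2r.
- move=> V oV [z Vz].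
  have : nbhs (phi z) (g @^-1` V).
    by apply: cg; rewrite phiK; exact: open_nbhs_nbhs.
  move=> /nbhs_boxP [e e0 He].
  have lt1 : (phi z).1 - e < (phi z).1 + e by lra.
  have lt2 : (phi z).2 - e < (phi z).2 + e by lra.
  have [a /itvP ha] := rat_in_itvoo lt1; have [b /itvP hb] := rat_in_itvoo lt2.
  pose y := g (ratr a, ratr b).
  have Vy : V y by apply: He; rewrite ltr_distlC /= ?ha ?hb.
  have : nbhs (p y) (psi y @^-1` V).
    by apply: (chart_continuous (ch y)); rewrite pz; exact: open_nbhs_nbhs.
  move=> /nbhs_boxP [e' e'0 He'].
  pose k := Num.bound e'^-1.
  have kP : k.+1%:R^-1 < e' :> R.
    rewrite invf_plt ?posrE ?ltr0n //.
    apply: lt_trans (archi_boundP _) _; first by rewrite invr_ge0 ltW.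
    by rewrite ltr_nat.
  exists (pickle (a, b, k)) => s s01.
  rewrite /d /r /idx pickleK /= -/y; apply: He' => /=.
    by rewrite subrr normr0.
  rewrite opprD addrA subrr add0r normrN ger0_norm; last first.
    by rewrite mulr_ge0 ?invr_ge0 ?ler0n //; case/andP: s01.
  apply: le_lt_trans kP; rewrite ler_piMl ?invr_ge0 ?ler0n //;
    by case/andP: s01.
- move=> n s t st; set z := d n.
  pose W := [set w : R * R | (p z).2 + s * r n < w.2 /\ w.2 < (p z).2 + t * r
    n].
  have lt : (p z).2 + s * r n < (p z).2 + t * r n by rewrite ltrD2l ltr_pM2r.
  have oW : open W.
    rewrite openE => -[a b] [/= h1 h2]; apply/nbhs_boxP.
    exists (Num.min (b - ((p z).2 + s * r n)) ((p z).2 + t * r n - b)).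
      by rewrite lt_min !subr_gt0 h1.
    move=> [a' b'] /= _; rewrite lt_min !ltr_distlC /W /=; lra.
  exists (psi z @` W); split; first exact: chart_open (ch z) _ oW.
    exists (psi z ((p z).1, ((p z).2 + s * r n + ((p z).2 + t * r n)) / 2)).
    by exists ((p z).1, ((p z).2 + s * r n + ((p z).2 + t * r n)) / 2) => //;
      rewrite /W /=; lra.
  move=> _ [[a b] [/= h1 h2] <-].
  have l := chart_lf_p a (p z).1 b (ch z).
  split.
    apply: (leaf_le_trans (y := psi z ((p z).1, b)));
      last exact/leaf_le_lf/lf_sym.
    by apply: leaf_le_m; rewrite (chart_m (ch z)).
  apply: (leaf_le_trans (y := psi z ((p z).1, b))); first exact: leaf_le_lf.
  by apply: leaf_le_m; rewrite (chart_m (ch z)).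
Qed.

Lemma leaf_coordinate : exists e : P -> R,
  [/\ forall x y, leaf_le x y -> e x <= e y,
      forall x y, e x < e y <-> exists O, [/\ open O, O !=set0 &
          forall p, O p -> leaf_le x p /\ leaf_le p y]
    & forall u v x y, u < v -> e x <= u -> v <= e y ->
        exists z, u < e z /\ e z < v].
Proof.
have [sigma [s1 s2 s3]] := dense_segments.
have [||||e [e1 e2 e3]] := @order_to_real R P leaf_le sigma.
- exact: leaf_le_total.
- exact: leaf_le_trans.
- by move=> n s t /(s1 n)/leaf_le_m.
- by move=> n s t /(s1 n)/leaf_lt_m.
exists e; split=> // x y; rewrite e2; split.
  move=> [n [s [t [s0 st t1 xs ty]]]]; have [V [oV V0 hV]] := s3 n s t st.
  exists V; split=> // p /hV [h1 h2].
  by split; [exact: leaf_le_trans h1|exact: leaf_le_trans ty].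
move=> [V [oV V0 hV]]; have [n hn] := s2 V oV V0; exists n, 0, 1; split;
  try lra.
  by have [] := hV _ (hn 0 ltac:(lra)).
by have [] := hV _ (hn 1 ltac:(lra)).
Qed.

(** The open set is a horizontal strip of a chart just above [x], thin enough to stay before [y]. *)
Lemma leaf_coordinate_m (e : P -> R) :
  (forall x y, e x < e y <-> exists O, [/\ open O, O !=set0 &
          forall p, O p -> leaf_le x p /\ leaf_le p y]) ->
  forall x y, pm x y -> e x < e y.
Proof.
move=> eP x y xy; rewrite eP.
have [psi [[s t] [ch xE]]] := bif_chart bif x.
have [t' tt' le_y] : exists2 t', t < t' & leaf_le (psi (s, t')) y.
  have lqy : lf pm (psi (s, t + 1)) y.
    apply: (lf_trans linesM) (Or32 _ _ xy); rewrite -xE; exact: chart_lf_m ch.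
  case: lqy => [->|h|h].
  - exists (t + 1); first lra.
    by apply: leaf_le_lf; exact: lf_refl.
  - by exists (t + 1); [lra|exact: leaf_le_m].
  - have := xy; rewrite -xE => xy';
    have [t' e'] := chart_between_m bif ch xy' h.
    exists t'; last by rewrite e'; apply: leaf_le_lf; exact: lf_refl.
    by rewrite -(chart_m ch s) e'.
pose W := [set w : R * R | t < w.2 /\ w.2 < t'].
exists (psi @` W); split.
- apply: (chart_open ch); rewrite openE => -[a b] [/= h1 h2]; apply/nbhs_boxP.
  exists (Num.min (b - t) (t' - b)); first by rewrite lt_min !subr_gt0 h1.
  move=> [a' b'] /= _; rewrite lt_min !ltr_distlC /W /=; lra.
- by exists (psi (s, (t + t') / 2)), (s, (t + t') / 2) => //; rewrite /W /=;
  lra.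
- move=> _ [[a b] [/= h1 h2] <-]; have l := chart_lf_p a s b ch; split.
    apply: (leaf_le_trans (y := psi (s, b))); last exact/leaf_le_lf/lf_sym.
    by apply: leaf_le_m; rewrite -xE (chart_m ch).
  apply: (leaf_le_trans (y := psi (s, b))); first exact: leaf_le_lf.
  by apply: leaf_le_trans le_y; apply: leaf_le_m; rewrite (chart_m ch).
Qed.

End leaf_order.

(** * Invariance of sides, quadrants and heights under automorphisms *)

Section equivariance.
Variables (R : realType) (P : topologicalType).
Implicit Types (pp pm : P -> P -> Prop).

Definition automorphism pp pm (f : P -> P) : Prop :=
  [/\ continuous f, (forall x y, pp x y -> pp (f x) (f y))
    & forall x y, pm x y -> pm (f x) (f y)].

Lemma automorphism_swap pp pm f : automorphism pp pm f -> automorphism pm pp f.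
Proof. by case. Qed.

Lemma lf_image pp pm f x y : automorphism pp pm f -> lf pp x y -> lf pp (f x)
  (f y).
Proof.
by move=> [_ h _] [->|/h|/h]; [exact: Or31|exact: Or32|exact: Or33].
Qed.

Section inverse.
Variables (pp pm : P -> P -> Prop) (f f' : P -> P).
Hypothesis bif : bifoliation R pp pm.
Hypothesis fa : automorphism pp pm f.
Hypothesis fa' : automorphism pp pm f'.
Hypothesis fK : cancel f f'.
Hypothesis f'K : cancel f' f.

Lemma lf_imageE x y : lf pp (f x) (f y) <-> lf pp x y.
Proof.
split; last exact: lf_image fa.
by move=> /(lf_image fa'); rewrite !fK.
Qed.

(** The preimage of the upper side at [f x] is an upper side at [x], and upper sides are unique. *)
Lemma above_image x y : above pp pm x y -> above pp pm (f x) (f y).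
Proof.
have [cf fp fm] := fa.
have [oA oA' dA nA pA] := above_side bif (f x).
apply: (@upper_side_uniq _ _ _ _ bif x (f @^-1` above pp pm (f x))); split.
- by apply: open_comp => // z _; exact: cf.
- have -> : ~` (f @^-1` above pp pm (f x) `|` lf pp x) =
      f @^-1` (~` (above pp pm (f x) `|` lf pp (f x))).
    apply/seteqP; split=> z /= h [h'|h']; apply: h; [by left| |by left|].
      by right; apply/lf_imageE.
    by right; exact: (lf_image fa).
  by apply: open_comp => // z _; exact: cf.
- by move=> z /dA h /(lf_image fa).
- by move=> u z /(lf_image fa) h /fm; exact: nA.
- move=> u z /(lf_image fa) h /fm h' [k|/(lf_image fa) k]; apply: (pA _ _ h h').
    by left.
  by right.
Qed.

End inverse.

Section inverse2.
Variables (pp pm : P -> P -> Prop) (f f' : P -> P).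
Hypothesis bif : bifoliation R pp pm.
Hypothesis fa : automorphism pp pm f.
Hypothesis fa' : automorphism pp pm f'.
Hypothesis fK : cancel f f'.
Hypothesis f'K : cancel f' f.

Lemma upper_imageE x y : upper pp pm (f x) (f y) <-> upper pp pm x y.
Proof.
split=> -[h|h].
- by left; have := above_image bif fa' fa f'K h; rewrite !fK.
- by right; apply/(lf_imageE fa fa' fK).
- by left; exact: (above_image bif fa fa' fK).
- by right; exact: (lf_image fa).
Qed.

End inverse2.

Section inverse3.
Variables (pp pm : P -> P -> Prop) (f f' : P -> P).
Hypothesis bif : bifoliation R pp pm.
Hypothesis fa : automorphism pp pm f.
Hypothesis fa' : automorphism pp pm f'.
Hypothesis fK : cancel f f'.
Hypothesis f'K : cancel f' f.

Lemma quad_image q a : quad pp pm (f q) (f a) = quad pp pm q a.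
Proof.
have fib := bifoliation_swap bif.
have fs := automorphism_swap fa; have fs' := automorphism_swap fa'.
apply: quad_equiv; rewrite (upper_imageE bif fa fa' fK f'K).
suff -> : meets_right pp pm (f q) (f a) <-> meets_right pp pm q a by [].
split=> -[u au qu].
  exists (f' u); first by rewrite -(lf_imageE fa fa' fK) f'K.
  by rewrite -(upper_imageE fib fs fs' fK f'K) f'K.
exists (f u); first exact: (lf_image fa).
by rewrite (upper_imageE fib fs fs' fK f'K).
Qed.

(** The height transported by [f] satisfies the rules that characterize the height of base [a]. *)
Lemma height_image a x : height pp pm (f a) (f x) = height pp pm a x.
Proof.
suff <- : (fun x => height pp pm (f a) (f x)) = height pp pm a by [].
apply: (height_unique bif _ (heightP bif a)).
have [h0 hp hm] := heightP bif (f a); have [_ fp fm] := fa; split=> //.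
- by move=> y z /fp; exact: hp.
- move=> y z /fm /hm; rewrite !quad_image.
  have same_image u : same_leaf pp (f u) (f a) = same_leaf pp u a.
    rewrite /same_leaf; congr (Posz (nat_of_bool _)); apply: asbool_equiv_eq.
    exact: lf_imageE fa fa' fK _ _.
  by rewrite !same_image.
Qed.

End inverse3.
End equivariance.

(** * The action *)

Section bridge.
Variables (R : realType) (P : topologicalType).

Lemma partition_unique (F : set (set P)) l m x :
  partition F id setT -> F l -> F m -> l x -> m x -> l = m.
Proof. by move=> [_ tF _] Fl Fm lx mx; apply: tF => //; exists x. Qed.

Lemma partition_cover (F : set (set P)) x :
  partition F id setT -> exists2 l, F l & l x.
Proof. by move=> [cF _ _]; have : cover F id x by rewrite cF. Qed.

Lemma foliation_lines (F : set (set P)) prec : is_plane R P ->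
  foliation_by_oriented_lines R F prec -> oriented_lines R prec.
Proof.
move=> planeP [pF sl pl] x.
have [l Fl lx] := partition_cover x pF.
have [c [cc ci cK rc] cP] := pl l Fl.
exists c; split=> //.
- exact: plane_proper_closed.
- by have [r _ <-] : range c x by [rewrite rc]; exists r.
- move=> s y h.
  have ly : l y.
    have [m Fm [mc my]] : exists2 m, F m & m (c s) /\ m y.
      by case: h => /sl [m Fm [h1 h2]]; exists m.
    suff -> : l = m by [].
    by apply: (partition_unique pF Fl Fm _ mc); rewrite -rc; exists s.
  by have [r _ <-] : range c y by [rewrite rc]; exists r.
Qed.

Lemma foliation_lf (F : set (set P)) prec l x :
  foliation_by_oriented_lines R F prec -> F l -> l x -> lf prec x = l.
Proof.
move=> [pF sl pl] Fl lx; apply/seteqP; split=> y.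
  have side u v : prec u v -> forall m, F m -> m u <-> m v.
    move=> /sl [n Fn [nu nv]] m Fm; split=> h.
      by rewrite (partition_unique pF Fm Fn h nu).
    by rewrite (partition_unique pF Fm Fn h nv).
  case=> [->//|h|h]; first exact: (side _ _ h _ Fl).1 lx.
  exact: (side _ _ h _ Fl).2 lx.
have [c [cc ci cK rc] cP] := pl l Fl; rewrite -rc in lx *.
by move: lx => [s _ <-] [t _ <-]; exact: lf_path.
Qed.

Lemma chart_box Fp Fm (pp pm : P -> P -> Prop) U phi :
  bifoliated_chart Fp Fm U phi ->
  (forall y z, U y -> U z -> (phi y).2 = (phi z).2 ->
     (pp y z <-> (phi y).1 < (phi z).1)) ->
  (forall y z, U y -> U z -> (phi y).1 = (phi z).1 ->
     (pm y z <-> (phi y).2 < (phi z).2)) ->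
  exists2 psi : R * R -> P, box_chart pp pm psi & forall x,
    U x -> psi (phi x) = x.
Proof.
move=> [oU [[_ injU surjU] cphi [psi psiK cpsi]] _ _] hp hm.
have psiK' x : U x -> psi (phi x) = x by move=> Ux; apply: psiK; rewrite inE.
have inv z : U (psi z) /\ phi (psi z) = z.
  by have [x Ux <-] := surjU z I; rewrite psiK'.
have Up z := (inv z).1; have psiE z := (inv z).2.
exists psi => //; split.
- exact/continuous_subspace_setT.
- move=> V oV.
  have -> : psi @` V = U `&` phi @^-1` V.
    apply/seteqP; split=> [_ [z Vz <-]|x [Ux Vx]].
      by split=> //=; rewrite psiE.
    by exists (phi x) => //; exact: psiK'.
  rewrite openE => x [Ux Vx]; rewrite /interior.
  apply: filterI; first exact: open_nbhs_nbhs.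
  move: cphi; rewrite continuous_open_subspace // => /(_ x);
    rewrite inE => /(_ Ux).
  by apply; exact: open_nbhs_nbhs.
- by move=> x y e; rewrite -(psiE x) -(psiE y) e.
- by move=> s s' t; rewrite hp // !psiE.
- by move=> s t t'; rewrite hm // !psiE.
Qed.

Lemma bifoliated_plane_bifoliation Fp Fm (pp pm : P -> P -> Prop) :
  bifoliated_plane R Fp Fm pp pm -> bifoliation R pp pm.
Proof.
move=> [[phi [[_ _ surj] cphi [g gK cg]]] fp fm hc].
have planeP : is_plane R P.
  have gK' : cancel phi g by move=> x; apply: gK; rewrite inE.
  exists phi, g; split=> //; try exact/continuous_subspace_setT.
  by move=> z; have [x _ <-] := surj z I; rewrite gK'.
split=> //; [exact: foliation_lines fp|exact: foliation_lines fm|].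
move=> x; have [U [phi' [Ux ch hp hm]]] := hc x.
have [psi h psiK] := chart_box ch hp hm.
by exists psi, (phi' x); split=> //; exact: psiK.
Qed.

End bridge.

(** * Faithfulness of the action on the coordinate *)

Section faithful.
Variables (R : realType) (P : topologicalType) (Fp Fm : set (set P)).
Variables (pp pm : P -> P -> Prop) (G : groupType) (act : G -> P -> P).
Hypothesis hP : bifoliated_plane R Fp Fm pp pm.
Hypothesis hG : Anosov_like R act Fp Fm pp pm.

Let bif := bifoliated_plane_bifoliation hP.
Let linesP := bif_p bif.
Let linesM := bif_m bif.
Let action := Anosov_action hG.

Lemma act_automorphism g : automorphism pp pm (act g).
Proof.
split; [exact: act_continuous action g|exact: act_precp action g|exact:
  act_precm action g].
Qed.

Lemma actK g : cancel (act g) (act g^-1%g).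
Proof. by move=> x; rewrite -(act_mul action) mulVg (act_one action). Qed.

Lemma actVK g : cancel (act g^-1%g) (act g).
Proof. by move=> x; rewrite -(act_mul action) mulgV (act_one action). Qed.

Variable e : P -> R.
Hypothesis e_le : forall x y, leaf_le pp pm x y -> e x <= e y.
Hypothesis e_lt : forall x y, e x < e y <-> exists O, [/\ open O, O !=set0 &
  forall p, O p -> leaf_le pp pm x p /\ leaf_le pp pm p y].

Lemma coordinate_act_lt g x y : e x < e y -> e (act g x) < e (act g y).
Proof.
have im (h : G) u v : leaf_le pp pm (act h u) (act h v) <-> leaf_le pp pm u v.
  by rewrite /leaf_le (height_image bif (act_automorphism h) (act_automorphism
    h^-1%g) (actK h) (actVK h)).
rewrite !e_lt => -[V [oV [v Vv] hV]].
exists (act g^-1%g @^-1` V); split.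
- by apply: open_comp => // z _; exact: act_continuous action g^-1%g z.
- by exists (act g v); rewrite /= actK.
- move=> p /= /hV [h1 h2].
  by rewrite -(actVK g p) !im.
Qed.

Let em := leaf_coordinate_m bif e_lt.

Lemma coordinate_lf x y : lf pp x y -> e x = e y.
Proof.
move=> h; have := e_le (leaf_le_lf bif h).
have := e_le (leaf_le_lf bif (lf_sym h)); lra.
Qed.

Lemma coordinate_m_inj x y : lf pm x y -> e x = e y -> y = x.
Proof. by case=> [->//|/em|/em] h1 h2; move: h1; rewrite h2 ltxx. Qed.

(** Strict inequalities between coordinates give [H w z] nonnegative and [H y z] negative. By
    [height_base_m], [quad _ z] must drop between [w] and [y]: the end of [z] is passed there. *)
Lemma coordinate_strip w x y z : pm w x -> pm x y -> e z = e x ->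
  upper pp pm w z /\ below pp pm y z.
Proof.
move=> wx xy zx; have := em wx; have := em xy; rewrite -zx => zy wz.
have n1 : ~ leaf_le pp pm z w by move/e_le; lra.
have n2 : ~ leaf_le pp pm y z by move/e_le; lra.
have h1 : leaf_le pp pm w z by have [] := leaf_le_total bif w z.
have wy : lf pm w y by apply/Or32/(prec_trans linesM wx).
have := height_base_m bif z wy; move: h1 n2; rewrite /leaf_le.
case: (quadP pp pm w z) => -[-> h1]; case: (quadP pp pm y z) => -[-> h2] k1 k2;
  try lia.
case: h1 => mw uw _; split=> // uy; apply: h2; split=> //;
  exact: (mr_m bif wy mw).
Qed.

(** [k] keeps [x0] below and [d] above the leaf of [d2], so the [pm]-leaf through their images
    crosses that leaf at some [p]. The preimage of [p] is on the [pm]-leaf of [d2] and has the same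
    coordinate as [d2], hence equals [d2]: this is how [k] comes to fix a leaf. *)
Lemma coordinate_faithful k : (forall x, e (act k x) = e x) -> k = 1%g.
Proof.
move=> ek; apply: contrapT => k1.
have [x0] : exists x : P, True.
  have [phi [g _]] := bif_plane bif; by exists (g (0, 0)).
move=> _.
(* Five points in order on one [pm]-leaf: the leaf of [d2] bounds from above the strip that traps
   the image of [x0], and from below the one that traps the image of [d]. *)
have [w wx] := lf_prev linesM x0; have [d2 xd2] := lf_next linesM x0.
have [d dd2] := lf_next linesM d2; have [d4 dd4] := lf_next linesM d.
have [_ low] := coordinate_strip wx xd2 (ek x0).
have [high _] := coordinate_strip dd2 dd4 (ek d).
have fa := act_automorphism k.
have xd : lf pm x0 d by apply/Or32/(prec_trans linesM xd2).
have [p xp dp] : exists2 p, lf pm (act k x0) p & lf pp d2 p.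
  apply: contrapT => n.
  have nl z : lf pm (act k x0) z -> ~ lf pp d2 z by move=> xz dz; apply: n;
    exists z.
  have := connected_below bif (@lf_connected _ _ _ linesM (act k x0)) nl
    (lf_refl _ _) low.
  by move=> /(_ _ (lf_image (automorphism_swap fa) xd)); apply.
pose q := act k^-1%g p.
have kq : act k q = p by rewrite /q actVK.
have xq : lf pm x0 q.
  by rewrite -(lf_imageE (automorphism_swap fa) (automorphism_swap
    (act_automorphism k^-1%g)) (actK k)) kq.
have qd2 : q = d2.
  apply: coordinate_m_inj; first by apply: (lf_trans linesM) xq; exact: Or33.
  by rewrite -(ek q) kq; exact: coordinate_lf.
have fix2 : lf pp d2 (act k d2) by rewrite -qd2 kq qd2.
have [l Fl ld2] := partition_cover d2 (leaves_partition (foliation_p hP)).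
have lE := foliation_lf (foliation_p hP) Fl ld2.
have fixl : fixes_leaf act k l.
  have stab g : lf pp d2 (act g d2) -> forall y, l y -> l (act g y).
    rewrite -lE => h y /(lf_image (act_automorphism g));
      exact: (lf_trans linesP).
  apply/seteqP; split=> [_ [y ly <-]|y ly]; first exact: stab.
  exists (act k^-1%g y); last exact: actVK.
  apply: stab => //;
    rewrite -(lf_imageE fa (act_automorphism k^-1%g) (actK k)) actVK.
  exact: lf_sym.
have [x1 [lp [lm [_ kx1 _ [Flm lmx1] dyn]]]] :=
  Anosov_A1 hG k1 (or_introl Fl) fixl.
have lmE := foliation_lf (foliation_m hP) Flm lmx1.
have [y x1y] := lf_next linesM x1.
have lmy : lm y by rewrite -lmE; exact: Or32.
have ky : act k y = y.
  apply: coordinate_m_inj => //.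
  rewrite -(lf_eq linesM (Or32 _ _ x1y : lf pm x1 y)) -{1}kx1.
  by apply: (lf_image (automorphism_swap fa)); exact: Or32.
have k'y : act k^-1%g y = y by rewrite -{1}ky actK.
have limit g : act g y = y -> contracting_on act g lm x1 -> False.
  move=> gy /(_ y lmy).
  have -> : (fun n : nat => act (g ^+ n)%g y) = fun=> y.
    apply/funext; elim=> [|n IH]; first by rewrite expg0 (act_one action).
    by rewrite expgS (act_mul action) IH.
  move=> h; have yx1 : y = x1.
    by apply: (cvg_unique (plane_hausdorff (bif_plane bif)) (cvg_cst y) h).
  by move: x1y; rewrite yx1; exact: (prec_irr linesM).
by case: dyn => -[h1 h2]; [exact: limit h2|exact: (limit _ k'y h2)].
Qed.

End faithful.

Theorem corollary2 (R : realType) (P : topologicalType)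
    (Fp Fm : set (set P)) (precp precm : P -> P -> Prop)
    (G : groupType) (act : G -> P -> P)
    (hP : bifoliated_plane R Fp Fm precp precm)
    (hG : Anosov_like R act Fp Fm precp precm) :
  exists rho : G -> R -> R,
    [/\ forall g : G, homeo_plus (rho g),
        forall g h : G, rho (g * h)%g = rho g \o rho h
      & injective rho].
Proof.
have action := Anosov_action hG.
have [e [e_le e_lt e_gapless]] :=
  leaf_coordinate (bifoliated_plane_bifoliation hP).
have [rho [rho_homeo rhoM rhoE]] := dense_action_extension e_gapless
  (act_one action) (act_mul action) (coordinate_act_lt hP hG e_lt).
exists rho; split=> // g h gh.
suff /(congr1 (fun x => (g * x)%g)) : (g^-1 * h)%g = 1%g by
  rewrite mulgA mulgV mul1g mulg1.
apply: (coordinate_faithful hP hG e_le e_lt) => x.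
by rewrite -rhoE rhoM -gh -rhoM mulVg rhoE (act_one action).
Qed.
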